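(* Let $f_t=\prod_{n\ge 1}(1-q^{nt})$ and define integers $p_j(n)$ by $f_1^{j}=\sum_{n\ge0}p_j(n)q^n$. Let $C_k(\beta)$ and $D_{k,i}(\beta)$ ($1\le k\le 8$, $1\le i\le\lfloor k/3\rfloor$, $\beta\ge 0$) be the integer sequences which, for each fixed $k$ (and $i$), all satisfy the recurrence $$s(\beta+4)=h(k)\,s(\beta+2)+r(k)\,s(\beta)\qquad(\beta\ge 0),$$ with the following coefficients and initial values $(s(0),s(1),s(2),s(3))$: - $k=1$: $h=-3$, $r=0$; $C_1:(1,-3,-3,9)$. - $k=2$: $h=3^2$, $r=0$; $C_2:(1,9,9,81)$. - $k=3$: $h=-2^2\cdot 3$, $r=-3^7$; $C_3:(1,0,-12,-2187)$; $D_{3,1}:(0,1,-243,-12)$. - $k=4$: $h=-2\cdot3^2\cdot19$, $r=-3^{10}$; $C_4:(1,-243,-99,24057)$; $D_{4,1}:(0,-12,2916,4104)$. - $k=5$: $h=2^2\cdot3^3\cdot17$, $r=-3^{13}$; $C_5:(1,2187,1107,2421009)$; $D_{5,1}:(0,90,-21870,165240)$. - $k=6$: $h=-2\cdot3^2\cdot17\cdot23$, $r=-3^{16}$; $C_6:(1,-13122,-7038,49305915)$; $D_{6,1}:(0,-486,118098,3420468)$; $D_{6,2}:(0,1,-177147,-7038)$. - $k=7$: $h=2^2\cdot3^3\cdot491$, $r=-3^{19}$; $C_7:(1,59049,33345,1968988905)$; $D_{7,1}:(0,1701,-413343,90200628)$; $D_{7,2}:(0,-21,3720087,-1113588)$.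 - $k=8$: $h=-2\cdot3^4\cdot5\cdot359$, $r=-3^{22}$; $C_8:(1,-177147,-113643,20131516521)$; $D_{8,1}:(0,0,0,0)$; $D_{8,2}:(0,252,-44641044,-73279080)$. Then for every $\beta\ge0$ and $1\le k\le 8$, as formal Laurent series in $q$, $$\sum_{n=0}^\infty p_{3k}\Big(3^{2\beta}n+\frac{k(3^{2\beta}-1)}{8}\Big)q^n=C_k(2\beta)f_1^{3k}+\sum_{i=1}^{\lfloor k/3\rfloor}D_{k,i}(2\beta)\,q^{i}f_1^{3k-12i}f_3^{12i}$$ and $$\sum_{n=-\lfloor k/3\rfloor}^\infty p_{3k}\Big(3^{2\beta+1}n+\frac{k(3^{2\beta+2}-1)}{8}\Big)q^n=C_k(2\beta+1)f_3^{3k}+\sum_{i=1}^{\lfloor k/3\rfloor}D_{k,i}(2\beta+1)\,q^{-i}f_1^{12i}f_3^{3k-12i}.$$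
   Context: All identities are between formal Laurent series in $q$ with integer coefficients; negative powers of $f_t$ are the inverses of $f_t$ in the ring of formal power series. Empty sums are $0$. *)

(* Defs.v *)
From HB Require Import structures.
From mathcomp Require Import all_boot all_order all_algebra.
From mathcomp Require Import boolp classical_sets fsbigop.
From mathcomp Require Import zify.

Set Implicit Arguments.
Unset Strict Implicit.
Unset Printing Implicit Defensive.

Import Order.TTheory GRing.Theory Num.Theory.

Local Open Scope ring_scope.

(* A formal Laurent series sum_n (coef n) q^n is its family of coefficients   *)
(* indexed by int, vanishing for all sufficiently negative indices.           *)
Record laurent (R : comNzRingType) := Laurent {
  coef :> int -> R;
  coef_lb : exists m : int, forall n, n < m -> coef n = 0 }.

HB.instance Definition _ (R : comNzRingType) := gen_eqMixin (laurent R).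
HB.instance Definition _ (R : comNzRingType) := gen_choiceMixin (laurent R).

Lemma laurentP (R : comNzRingType) (f g : laurent R) : f =1 g -> f = g.
Proof.
case: f g => [f hf] [g hg] /= /funext fg.
by case: _ / fg hg => hg; rewrite (Prop_irrelevance hf hg).
Qed.

Section Ring.
Variable R : comNzRingType.
Implicit Types (f g h : laurent R) (m n : int).

Definition vanishes_below (a : int -> R) m := forall n, n < m -> a n = 0.

Lemma vanishesW a m m' :
  vanishes_below a m -> m' <= m -> vanishes_below a m'.
Proof. by move=> am mm n nm; apply: am; apply: lt_le_trans mm. Qed.

Definition add_coef f g n := f n + g n.
Definition mul_coef f g n := \sum_(i \in [set: int]) f i * g (n - i).

Lemma mul_coefE f g m m' n K :
    vanishes_below f m -> vanishes_below g m' -> n < m + m' + K%:Z ->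
  mul_coef f g n = \sum_(i < K) f (m + i%:Z) * g (n - (m + i%:Z)).
Proof.
move=> fm gm nK; rewrite /mul_coef.
rewrite (fsbigE [seq m + i%:Z | i <- iota 0 K]) //.
  rewrite big_map -{1}[K]subn0 -/(index_iota 0 K) big_mkord.
  by apply: eq_bigl => i; rewrite in_setT.
  by rewrite map_inj_uniq ?iota_uniq// => i j /addrI [].
move=> i _; apply: contraNeq => fg.
have mi : m <= i.
  by rewrite leNgt; apply: contraNN fg => im; rewrite fm ?mul0r.
have im' : i <= n - m'.
  rewrite leNgt; apply: contraNN fg => ni; rewrite (gm (n - i)) ?mulr0//.
  by lia.
by apply/mapP; exists `|i - m|%N; first rewrite mem_iota; lia.
Qed.

Lemma add_lb f g : exists m, vanishes_below (add_coef f g) m.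
Proof.
have [[m fm] [m' gm]] := (coef_lb f, coef_lb g).
exists (Num.min m m') => n; rewrite lt_min => /andP[nm nm'].
by rewrite /add_coef fm ?gm ?addr0.
Qed.

Lemma opp_lb f : exists m, vanishes_below (fun n => - f n) m.
Proof. by have [m fm] := coef_lb f; exists m => n nm; rewrite fm ?oppr0. Qed.

Lemma mul_lb f g : exists m, vanishes_below (mul_coef f g) m.
Proof.
have [[m fm] [m' gm]] := (coef_lb f, coef_lb g).
by exists (m + m') => n nm; rewrite (mul_coefE (K := 0) fm gm) ?big_ord0 ?addr0.
Qed.

Lemma const_lb (c : R) : exists m, vanishes_below (fun n => c *+ (n == 0)) m.
Proof. by exists 0 => n n0; rewrite lt_eqF. Qed.

Definition addl f g := Laurent (add_lb f g).
Definition oppl f := Laurent (opp_lb f).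
Definition mull f g := Laurent (mul_lb f g).
Definition constl c := Laurent (const_lb c).

Lemma addlA : associative addl.
Proof. by move=> f g h; apply/laurentP => n; exact: addrA. Qed.
Lemma addlC : commutative addl.
Proof. by move=> f g; apply/laurentP => n; exact: addrC. Qed.
Lemma add0l : left_id (constl 0) addl.
Proof. by move=> f; apply/laurentP => n /=; rewrite /add_coef /= mul0rn add0r. Qed.
Lemma addNl : left_inverse (constl 0) oppl addl.
Proof.
by move=> f; apply/laurentP => n /=; rewrite /add_coef /= mul0rn addNr.
Qed.

HB.instance Definition _ := GRing.isZmodule.Build (laurent R)
  addlA addlC add0l addNl.

(* f agrees with q^m P modulo q^(m+K) *)
Definition agrees f m K (P : {poly R}) :=
  vanishes_below f m /\ forall i, (i < K)%N -> f (m + i%:Z) = P`_i.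

Lemma agrees_poly f m K :
  vanishes_below f m -> agrees f m K (\poly_(i < K) f (m + i%:Z)).
Proof. by move=> fm; split=> // i iK; rewrite coef_poly iK. Qed.

Lemma agrees_mul f g m m' K P Q :
  agrees f m K P -> agrees g m' K Q -> agrees (mull f g) (m + m') K (P * Q).
Proof.
move=> [fm fP] [gm gQ]; split=> [n nm|i iK] /=.
  by rewrite (mul_coefE (K := 0) fm gm) ?big_ord0 ?addr0.
rewrite (mul_coefE (K := i.+1) fm gm); last by lia.
rewrite coefM; apply: eq_bigr => -[j /= ji] _.
have ji' : (j <= i)%N by rewrite -ltnS.
rewrite fP ?(leq_ltn_trans ji')//; congr (_ * _).
rewrite -gQ ?(leq_ltn_trans (leq_subr _ _))//; congr (g _).
by lia.
Qed.

Lemma agrees_add f g m K P Q :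
  agrees f m K P -> agrees g m K Q -> agrees (addl f g) m K (P + Q).
Proof.
move=> [fm fP] [gm gQ]; rewrite /agrees /= /add_coef; split=> [n nm|i iK].
  by rewrite fm ?gm ?addr0.
by rewrite fP ?gQ ?coefD.
Qed.

Lemma agrees_one K : agrees (constl 1) 0 K 1.
Proof.
split=> [n n0|i iK] /=; first by rewrite lt_eqF.
by rewrite coef1 add0r; case: i {iK}.
Qed.

Lemma agrees_eq f g m :
  (forall K, exists2 P, agrees f m K P & agrees g m K P) -> f = g.
Proof.
move=> fg; apply/laurentP => n.
have [nm|mn] := ltP n m.
  by have [P [fm _] [gm _]] := fg 0%N; rewrite fm ?gm.
have [P [_ fP] [_ gP]] := fg `|n - m|.+1%N.
have nE : n = m + `|n - m|%N by lia.
by rewrite [in LHS]nE [in RHS]nE fP ?gP.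
Qed.

Lemma mullA : associative mull.
Proof.
move=> f g h; have [[a fa] [b gb] [c hc]] :=
  And3 (coef_lb f) (coef_lb g) (coef_lb h).
apply: (@agrees_eq _ _ (a + b + c)) => K.
have [fP gQ hS] :=
  And3 (agrees_poly K fa) (agrees_poly K gb) (agrees_poly K hc).
eexists; last exact: agrees_mul (agrees_mul fP gQ) hS.
by rewrite -addrA -mulrA; apply: agrees_mul (agrees_mul gQ hS).
Qed.

Lemma mullC : commutative mull.
Proof.
move=> f g; have [[a fa] [b gb]] := (coef_lb f, coef_lb g).
apply: (@agrees_eq _ _ (a + b)) => K.
have [fP gQ] := (agrees_poly K fa, agrees_poly K gb).
eexists; first exact: agrees_mul fP gQ.
by rewrite addrC mulrC; apply: agrees_mul.
Qed.

Lemma mul1l : left_id (constl 1) mull.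
Proof.
move=> f; have [a fa] := coef_lb f.
apply: (@agrees_eq _ _ a) => K; have fP := agrees_poly K fa.
eexists; last exact: fP.
by rewrite -[a]add0r -[\poly_(_ < _) _]mul1r; apply: agrees_mul (agrees_one K) _;
   rewrite add0r.
Qed.

Lemma mullDl : left_distributive mull addl.
Proof.
move=> f g h; have [[a fa] [b gb] [c hc]] :=
  And3 (coef_lb f) (coef_lb g) (coef_lb h).
pose d := Num.min a b.
have {}fa : vanishes_below f d by apply: vanishesW fa _; rewrite ge_min lexx.
have {}gb : vanishes_below g d by apply: vanishesW gb _; rewrite ge_min lexx orbT.
apply: (@agrees_eq _ _ (d + c)) => K.
have [fP gQ hS] :=
  And3 (agrees_poly K fa) (agrees_poly K gb) (agrees_poly K hc).
eexists; first exact: agrees_mul (agrees_add fP gQ) hS.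
by rewrite mulrDl; apply: agrees_add; apply: agrees_mul.
Qed.

Lemma onel_neq0 : constl 1 != constl 0.
Proof.
apply/eqP => /(congr1 (fun f : laurent R => f 0)) /= /eqP.
by rewrite mul0rn oner_eq0.
Qed.

HB.instance Definition _ := GRing.Zmodule_isComNzRing.Build (laurent R)
  mullA mullC mul1l mullDl onel_neq0.

Definition unitl : {pred laurent R} := fun f => `[< exists g, g * f = 1 >].

Definition invl f :=
  if pselect (exists g, g * f = 1) is left e then projT1 (cid e) else f.

Lemma mulVl : {in unitl, left_inverse 1 invl *%R}.
Proof.
by move=> f /asboolP fU; rewrite /invl; case: pselect => // e; case: cid.
Qed.

Lemma unitlP f g : g * f = 1 -> unitl f.
Proof. by move=> gf; apply/asboolP; exists g. Qed.

Lemma invl_out : {in [predC unitl], invl =1 id}.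
Proof.
move=> f /negP fU; rewrite /invl; case: pselect => // e.
by case: fU; apply/asboolP.
Qed.

HB.instance Definition _ := GRing.ComNzRing_hasMulInverse.Build (laurent R)
  mulVl unitlP invl_out.

Lemma coef0l n : (0 : laurent R) n = 0.
Proof. exact: mul0rn. Qed.

Lemma coef1l n : (1 : laurent R) n = (n == 0)%:R.
Proof. by []. Qed.

Lemma coefDl f g n : (f + g) n = f n + g n.
Proof. by []. Qed.

Lemma coefNl f n : (- f) n = - f n.
Proof. by []. Qed.

Lemma coefMl f g n : (f * g) n = \sum_(i \in [set: int]) f i * g (n - i).
Proof. by []. Qed.

Lemma coef_suml I (r : seq I) (P : pred I) (F : I -> laurent R) n :
  (\sum_(i <- r | P i) F i) n = \sum_(i <- r | P i) F i n.
Proof. exact: (big_morph (fun f : laurent R => f n) (fun _ _ => erefl) (coef0l n)). Qed.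

Lemma vanishesM f g m m' : vanishes_below f m -> vanishes_below g m' ->
  vanishes_below (f * g) (m + m').
Proof.
by move=> fm gm n nm; rewrite coefMl -/(mul_coef f g n)
  (mul_coefE (K := 0) fm gm) ?big_ord0 ?addr0.
Qed.

Lemma vanishesX f m k : vanishes_below f m -> vanishes_below (f ^+ k) (m *+ k).
Proof.
move=> fm; elim: k => [|k IH].
  by move=> n; rewrite mulr0n expr0 coef1l => n0; rewrite lt_eqF.
by rewrite exprS mulrS; apply: vanishesM.
Qed.

(* The Laurent series sum_(n >= m) (a n) q^n. *)
Lemma lseries_lb m (a : int -> R) :
  exists m', vanishes_below (fun n => if m <= n then a n else 0) m'.
Proof. by exists m => n nm; rewrite leNgt nm. Qed.

Definition lseries m (a : int -> R) : laurent R := Laurent (lseries_lb m a).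

Lemma vanishes_lseries m a : vanishes_below (lseries m a) m.
Proof. by move=> n nm /=; rewrite leNgt nm. Qed.

Definition qvar : laurent R := lseries 1 (fun n => (n == 1)%:R).

Lemma coef_qvar n : qvar n = (n == 1)%:R.
Proof. by rewrite /=; case: leP => // n1; rewrite lt_eqF. Qed.

Lemma coef_qvarM f n : (qvar * f) n = f (n - 1).
Proof.
rewrite coefMl (fsbigE [:: 1]) //; last first.
  by move=> i _; rewrite inE coef_qvar => /negPf->; rewrite mul0r.
by rewrite big_cons big_nil in_setT coef_qvar mul1r; exact: addr0.
Qed.

Lemma qvar_unit : qvar \is a GRing.unit.
Proof.
apply/unitrPr; exists (lseries (-1) (fun n => (n == -1)%:R)).
apply/laurentP => n; rewrite coef_qvarM coef1l /= lerBrDr addNr.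
have -> : (n - 1 == -1) = (n == 0) by rewrite subr_eq addNr.
by case: leP => // n0; rewrite lt_eqF.
Qed.

Lemma coef_qvarXM m f n : (qvar ^ m * f) n = f (n - m).
Proof.
have pos k g n' : (qvar ^+ k * g) n' = g (n' - k%:Z).
  elim: k g n' => [|k IH] g n'; first by rewrite mul1r subr0.
  by rewrite exprSr -mulrA IH coef_qvarM -addrA -opprD intS [1 + _]addrC.
case: m => k; first exact: pos.
have /(congr1 (fun f : laurent R => f (n + k.+1%:Z))) :
    qvar ^+ k.+1 * (qvar ^ Negz k * f) = f.
  by rewrite mulrA NegzE -invr_expz mulrV ?mul1r ?unitrX ?qvar_unit.
by rewrite pos addrK NegzE opprK.
Qed.

Lemma coef_qvarX m n : (qvar ^ m) n = (n == m)%:R.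
Proof. by rewrite -[qvar ^ m]mulr1 coef_qvarXM coef1l subr_eq0. Qed.

(* A power series with constant term 1 is inverted by a power series. *)
Lemma series_inverse f : vanishes_below f 0 -> f 0 = 1 ->
  exists2 g : laurent R, vanishes_below g 0 & f * g = 1.
Proof.
move=> f0 f01; pose u := 1 - f.
have u1 : vanishes_below u 1.
  move=> n n1; rewrite /u coefDl coefNl coef1l.
  case: (ltgtP n 0) n1 => [n0 _|n0 n1|-> _]; last by rewrite f01 subrr.
    by rewrite f0// subr0.
  by lia.
have uX k n : n < k%:Z -> (u ^+ k) n = 0.
  by have := @vanishesX u 1 k u1; rewrite -[1 *+ _]/(k%:R) natz; apply.
pose S N := \sum_(k < N) u ^+ k.
pose g := lseries 0 (fun n => S `|n|.+1%N n).
exists g; first exact: vanishes_lseries.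
have fS N : f * S N = 1 - u ^+ N.
  have -> : f = 1 - u by rewrite /u opprB addrC subrK.
  by rewrite -opprB mulNr -subrX1 opprB.
have S0 N : vanishes_below (S N) 0.
  move=> n n0; rewrite coef_suml big1 // => k _.
  by apply: uX; lia.
have gS N n : n < N%:Z -> g n = S N n.
  move=> nN; rewrite /=; case: leP => n0; last by rewrite S0.
  have nN' : (`|n|.+1 <= N)%N by lia.
  rewrite !coef_suml -!(big_mkord xpredT (fun k => (u ^+ k) n)).
  rewrite [RHS](big_cat_nat (n := `|n|.+1%N))//= [X in _ + X]big1_seq ?addr0//.
  by move=> k; rewrite mem_index_iota => /andP[_ /andP[nk _]]; apply: uX; lia.
apply/laurentP => n; have [n0|n0] := ltP n 0.
  rewrite -[0]addr0 in n0.
  by rewrite (vanishesM f0 (vanishes_lseries _) n0) coef1l lt_eqF// -[0]addr0.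
have -> : (f * g) n = (f * S `|n|.+1%N) n.
  rewrite !coefMl -!/(mul_coef _ _ _).
  rewrite (mul_coefE (K := `|n|.+1%N) f0 (@vanishes_lseries 0 _)); last by lia.
  rewrite (mul_coefE (K := `|n|.+1%N) f0 (S0 _)); last by lia.
  by apply: eq_bigr => i _; rewrite (gS `|n|.+1%N)//; lia.
by rewrite fS coefDl coefNl uX ?subr0//; lia.
Qed.

End Ring.

Notation "'q" := (qvar int) (at level 0) : ring_scope.

Definition euler_partial (t N : nat) : laurent int :=
  \prod_(1 <= m < N.+1) (1 - 'q ^+ (m * t)).

(* The infinite product f_t = prod_(m >= 1) (1 - q^(m t)), for t >= 1: its n-th *)
(* coefficient is that of any partial product with at least n factors, the     *)
(* remaining factors being 1 modulo q^(n+1) (see coef_eulerE).                 *)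
Definition euler (t : nat) : laurent int :=
  lseries 0 (fun n => euler_partial t `|n| n).

Lemma euler_partialS t N :
  euler_partial t N.+1 = euler_partial t N * (1 - 'q ^+ (N.+1 * t)).
Proof. by rewrite /euler_partial big_nat_recr. Qed.

Lemma vanishes_euler_partial t N : vanishes_below (euler_partial t N) 0.
Proof.
elim: N => [|N IH].
  by move=> n n0; rewrite /euler_partial big_geq // coef1l lt_eqF.
rewrite euler_partialS -[0]addr0; apply: vanishesM IH _ => n n0.
rewrite coefDl coefNl coef1l lt_eqF// exprnP coef_qvarX.
by rewrite (_ : (n == _) = false) ?subr0//; apply/eqP; lia.
Qed.

Lemma coef_eulerE t N (n : nat) : (0 < t)%N -> (n <= N)%N ->
  euler t n = euler_partial t N n.
Proof.
move=> t0 nN /=; elim: N nN => [|N IH].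
  by rewrite leqn0 => /eqP->.
rewrite leq_eqVlt => /predU1P[->//|nN]; rewrite IH //.
rewrite euler_partialS mulrBr mulr1 coefDl coefNl mulrC exprnP coef_qvarXM.
rewrite [X in - X]vanishes_euler_partial ?subr0//.
by rewrite subr_lt0 ltz_nat (leq_trans nN)// leq_pmulr.
Qed.

Lemma euler_inverse t : (0 < t)%N ->
  exists2 g : laurent int, vanishes_below g 0 & euler t * g = 1.
Proof.
move=> t0; apply: series_inverse; first exact: vanishes_lseries.
by rewrite (coef_eulerE (N := 0))// /euler_partial big_geq.
Qed.

(* Hence negative powers of euler t, taken in the ring of Laurent series, are  *)
(* the inverses in the ring of power series.                                   *)
Lemma euler_unit t : (0 < t)%N -> euler t \is a GRing.unit.
Proof. by case/euler_inverse => g _ fg; apply/unitrPr; exists g. Qed.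

Definition p (j : nat) (n : int) : int := (euler 1 ^+ j) n.

Lemma shift_dvd (k b : nat) : (8 %| k * (3 ^ (2 * b) - 1))%N.
Proof.
apply: dvdn_mull; rewrite expnM; elim: b => // b IH.
by have -> : (((3 ^ 2) ^ b.+1) - 1 = (3 ^ 2) ^ b * 8 + ((3 ^ 2) ^ b - 1))%N;
  [rewrite expnS; have := expn_gt0 (3 ^ 2) b; lia | rewrite dvdn_add ?dvdn_mull].
Qed.

Definition solves (h r : int) (init : int * int * int * int) (s : nat -> int) :=
  let: (s0, s1, s2, s3) := init in
  [/\ s 0 = s0, s 1 = s1, s 2 = s2, s 3 = s3
    & forall b : nat, s b.+4 = h * s b.+2 + r * s b].

(* Large literals are written with %:R, which keeps them in decimal form; a   *)
(* bare literal of type int would be expanded in unary. Such literals are      *)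
(* handled by ring, but should not be reduced with /=.                        *)

Definition hrec (k : nat) : int :=
  match k with
  | 1%N => - 3%:R
  | 2%N => 3%:R ^+ 2
  | 3%N => - (2%:R ^+ 2 * 3%:R)
  | 4%N => - (2%:R * 3%:R ^+ 2 * 19%:R)
  | 5%N => 2%:R ^+ 2 * 3%:R ^+ 3 * 17%:R
  | 6%N => - (2%:R * 3%:R ^+ 2 * 17%:R * 23%:R)
  | 7%N => 2%:R ^+ 2 * 3%:R ^+ 3 * 491%:R
  | 8%N => - (2%:R * 3%:R ^+ 4 * 5%:R * 359%:R)
  | _ => 0
  end.

Definition rrec (k : nat) : int :=
  match k with
  | 3%N => - 3%:R ^+ 7
  | 4%N => - 3%:R ^+ 10
  | 5%N => - 3%:R ^+ 13
  | 6%N => - 3%:R ^+ 16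
  | 7%N => - 3%:R ^+ 19
  | 8%N => - 3%:R ^+ 22
  | _ => 0
  end.

Definition Cinit (k : nat) : int * int * int * int :=
  match k with
  | 1%N => (1, - 3%:R, - 3%:R, 9%:R)
  | 2%N => (1, 9%:R, 9%:R, 81%:R)
  | 3%N => (1, 0, - 12%:R, - 2187%:R)
  | 4%N => (1, - 243%:R, - 99%:R, 24057%:R)
  | 5%N => (1, 2187%:R, 1107%:R, 2421009%:R)
  | 6%N => (1, - 13122%:R, - 7038%:R, 49305915%:R)
  | 7%N => (1, 59049%:R, 33345%:R, 1968988905%:R)
  | 8%N => (1, - 177147%:R, - 113643%:R, 20131516521%:R)
  | _ => (0, 0, 0, 0)
  end.

Definition Dinit (k i : nat) : int * int * int * int :=
  match k, i with
  | 3%N, 1%N => (0, 1, - 243%:R, - 12%:R)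
  | 4%N, 1%N => (0, - 12%:R, 2916%:R, 4104%:R)
  | 5%N, 1%N => (0, 90%:R, - 21870%:R, 165240%:R)
  | 6%N, 1%N => (0, - 486%:R, 118098%:R, 3420468%:R)
  | 6%N, 2%N => (0, 1, - 177147%:R, - 7038%:R)
  | 7%N, 1%N => (0, 1701%:R, - 413343%:R, 90200628%:R)
  | 7%N, 2%N => (0, - 21%:R, 3720087%:R, - 1113588%:R)
  | 8%N, 1%N => (0, 0, 0, 0)
  | 8%N, 2%N => (0, 252%:R, - 44641044%:R, - 73279080%:R)
  | _, _ => (0, 0, 0, 0)
  end.

(* Main.v *)
Require Import Defs.
From HB Require Import structures.
From mathcomp Require Import all_boot all_order all_algebra.
From mathcomp Require Import zify ring.

Set Implicit Arguments.
Unset Strict Implicit.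
Unset Printing Implicit Defensive.

Import Order.TTheory GRing.Theory Num.Theory.

Local Open Scope ring_scope.

(* Put t = f_1^3 and s = f_3^3 = t(q^3). By Jacobi's identity
   t = sum_n (-1)^n (2n+1) q^(n(n+1)/2), whence t = a(q^3) - 3 q s(q^3) for some
   power series a. Taking norms over the subring of series in q^3 and using
   N(f_1) f_3 = f_1^4 gives s (a^3 - 27 q s^3) = t^4, so t is a root of a monic
   cubic with coefficients in that subring. Let U extract the exponents divisible
   by 3 and let tau = q^-1 t^4 / s^4. The cubic becomes the three-term recurrence
   w(e+3) = - 9 w(e+2) - 27 w(e+1) + tau w(e) for w(e) = s^-e U(q^-e t^e), over all
   integers e, so each w(e) is a Laurent polynomial in tau. Hence U(q^-k -) maps
   the span of t^k tau^-i (i <= k/3) to that of s^k tau^i, and U maps it back.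
   Both series of the theorem arise from t^k by alternating these two maps, so
   their coordinates follow a fixed linear system, which C and D also satisfy:
   it holds for their initial values, and both sides obey the recurrence. *)

(** * Substitution of q^3 and extraction of exponents modulo 3 *)

Lemma big_ord3 (V : nmodType) (F : nat -> V) m :
  \sum_(i < 3 * m) F i
  = \sum_(j < m) (F (3 * j)%N + F (3 * j).+1 + F (3 * j).+2).
Proof.
elim: m => [|m IH]; first by rewrite !big_ord0.
by rewrite mulnS addnC addn3 !big_ord_recr /= IH !addrA.
Qed.

Section Cube.
Variable R : comNzRingType.
Implicit Types (f g a b c : laurent R) (n m : int).

Lemma cube_lb f : exists m,
  vanishes_below (fun n => if (3 %| n)%Z then f (n %/ 3)%Z else 0) m.
Proof.
have [m fm] := coef_lb f; exists (3 * m) => n nm.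
by case: ifP => // _; apply: fm; lia.
Qed.

(* The series f(q^3). *)
Definition cube f : laurent R := Laurent (cube_lb f).

Lemma cubeE f n : cube f (3 * n) = f n.
Proof. by rewrite /= dvdz_mulr// mulrC mulzK. Qed.

Lemma cube_ndvd f n : ~~ (3 %| n)%Z -> cube f n = 0.
Proof. by move=> /= /negPf->. Qed.

Lemma vanishes_cube f m : vanishes_below f m -> vanishes_below (cube f) (3 * m).
Proof. by move=> fm n nm /=; case: ifP => // _; apply: fm; lia. Qed.

Lemma cubeB : zmod_morphism cube.
Proof.
move=> f g; apply/laurentP => n; rewrite coefDl coefNl /=.
by case: ifP => _; rewrite ?subr0// coefDl coefNl.
Qed.

Lemma cubeM : monoid_morphism cube.
Proof.
split=> [|f g].
  apply/laurentP => n; have [/dvdzP[m ->]|n3] := boolP (3 %| n)%Z.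
    by rewrite mulrC cubeE !coef1l; congr (_%:R); lia.
  rewrite cube_ndvd// coef1l (_ : (n == 0) = false)//.
  by apply/eqP => n0; rewrite n0 in n3.
have [[m fm] [m' gm]] := (coef_lb f, coef_lb g).
apply/laurentP => n; rewrite coefMl -/(mul_coef (cube f) (cube g) n).
pose K := (absz (n - 3 * m - 3 * m')%R).+1.
rewrite (mul_coefE (K := (3 * K)%N) (vanishes_cube fm) (vanishes_cube gm));
  last by rewrite /K; lia.
rewrite (big_ord3 (fun i => cube f (3 * m + i%:Z) * cube g (n - (3 * m + i%:Z)))).
under eq_bigr => j _.
  rewrite [in X in _ + X + _]cube_ndvd; last by lia.
  rewrite [in X in _ + X]cube_ndvd; last by lia.
  rewrite !mul0r !addr0 PoszM -mulrDr cubeE; over.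
have [/dvdzP[n' nE]|n3] := boolP (3 %| n)%Z.
  rewrite mulrC in nE; rewrite nE cubeE coefMl -/(mul_coef f g n').
  rewrite (mul_coefE (K := K) fm gm); last by rewrite /K; lia.
  by apply: eq_bigr => i _; rewrite -mulrBr cubeE.
rewrite cube_ndvd// big1// => i _.
by rewrite [cube g _]cube_ndvd ?mulr0//; lia.
Qed.

HB.instance Definition _ := GRing.isZmodMorphism.Build _ _ cube cubeB.
HB.instance Definition _ := GRing.isMonoidMorphism.Build _ _ cube cubeM.

Lemma cube_qvar : cube (qvar R) = qvar R ^+ 3.
Proof.
apply/laurentP => n; rewrite exprnP coef_qvarX.
have [/dvdzP[m ->]|n3] := boolP (3 %| n)%Z.
  by rewrite mulrC cubeE coef_qvar; congr (_%:R); lia.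
rewrite cube_ndvd// (_ : (n == 3) = false)//.
by apply/eqP => n0; rewrite n0 in n3.
Qed.

Lemma trisect_lb f : exists m, vanishes_below (fun n => f (3 * n)) m.
Proof.
have [m fm] := coef_lb f; exists (Num.min m 0) => n nm; apply: fm; lia.
Qed.

Definition trisect f : laurent R := Laurent (trisect_lb f).

Lemma trisectE f n : trisect f n = f (3 * n).
Proof. by []. Qed.

Lemma trisectB : zmod_morphism trisect.
Proof. by move=> f g; apply/laurentP. Qed.

HB.instance Definition _ := GRing.isZmodMorphism.Build _ _ trisect trisectB.

Lemma trisect_cube f : trisect (cube f) = f.
Proof. by apply/laurentP => n; rewrite trisectE cubeE. Qed.

Lemma trisect_qcube n f : trisect (qvar R ^ n * cube f) =
  if (3 %| n)%Z then qvar R ^ (n %/ 3)%Z * f else 0.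
Proof.
apply/laurentP => i; rewrite trisectE coef_qvarXM.
case: ifP => [/dvdzP[m ->]|n3].
  by rewrite mulzK// [m * 3]mulrC -mulrBr cubeE coef_qvarXM.
by rewrite coef0l cube_ndvd//; lia.
Qed.

(** These are the coordinates in the basis 1, q, q^2 over the series in q^3; [trisect_comp0],
    [trisect_comp1] and [trisect_comp2] give their uniqueness. *)
Lemma trisection f :
  f = cube (trisect f) + qvar R * cube (trisect (qvar R ^ (-1) * f))
      + qvar R ^+ 2 * cube (trisect (qvar R ^ (-2) * f)).
Proof.
apply/laurentP => n; rewrite !coefDl coef_qvarM (exprnP _ 2) coef_qvarXM.
have [m [->|->|->]] : exists m, [\/ n = 3 * m, n = 3 * m + 1 | n = 3 * m + 2].
- have : (n %% 3)%Z = 0 \/ (n %% 3)%Z = 1 \/ (n %% 3)%Z = 2 by lia.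
  by move=> [|[]] h; exists (n %/ 3)%Z; [apply: Or31|apply: Or32|apply: Or33]; lia.
- by rewrite cubeE !cube_ndvd ?addr0 ?trisectE//; lia.
- rewrite addrK cubeE !cube_ndvd ?addr0 ?add0r; [|lia|lia].
  by rewrite trisectE coef_qvarXM opprK.
- rewrite addrK cubeE !cube_ndvd ?addr0 ?add0r; [|lia|lia].
  by rewrite trisectE coef_qvarXM opprK.
Qed.

Lemma trisect_comp0 a b c :
  trisect (cube a + qvar R * cube b + qvar R ^+ 2 * cube c) = a.
Proof.
apply/laurentP => n; rewrite trisectE !coefDl cubeE coef_qvarM.
by rewrite (exprnP _ 2) coef_qvarXM !cube_ndvd ?addr0//; lia.
Qed.

Lemma trisect_comp1 a b c :
  trisect (qvar R ^ (-1) * (cube a + qvar R * cube b + qvar R ^+ 2 * cube c)) = b.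
Proof.
apply/laurentP => n; rewrite trisectE coef_qvarXM !coefDl coef_qvarM.
rewrite (exprnP _ 2) coef_qvarXM opprK addrK cubeE.
by rewrite !cube_ndvd ?addr0 ?add0r//; lia.
Qed.

Lemma trisect_comp2 a b c :
  trisect (qvar R ^ (-2) * (cube a + qvar R * cube b + qvar R ^+ 2 * cube c)) = c.
Proof.
apply/laurentP => n; rewrite trisectE coef_qvarXM !coefDl coef_qvarM.
rewrite (exprnP _ 2) coef_qvarXM opprK addrK cubeE.
by rewrite !cube_ndvd ?addr0 ?add0r//; lia.
Qed.

(** Multiplication by a series in q^3 acts on the three components separately. The coefficients of
    the cubic for t can thus be pulled out of U. *)
Lemma trisectM f g : trisect (cube f * g) = f * trisect g.
Proof.
rewrite {1}[g]trisection 2!mulrDr !(mulrCA (cube f)) -!rmorphM.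
exact: trisect_comp0.
Qed.
End Cube.

Lemma bin2_sqr k : ('C(k, 2) * 2 + k = k * k)%N.
Proof. by elim: k => // k; rewrite binS bin1; nia. Qed.

(** * A finite form of Jacobi's identity *)

Section FiniteJacobi.
Variables (R : comNzRingType) (x : R).

(** The Gaussian binomial, given by its Pascal rule so as to make sense in any ring. When m' exceeds
    n', the truncated [n' - m'] is harmless, its cofactor being 0. *)
Fixpoint qbinom (n m : nat) : R :=
  match n, m with
  | _, 0%N => 1
  | 0%N, _.+1 => 0
  | n'.+1, m'.+1 => qbinom n' m'.+1 + x ^+ (n' - m') * qbinom n' m'
  end.

Arguments qbinom : simpl never.

Lemma qbinomS n m :
  qbinom n.+1 m.+1 = qbinom n m.+1 + x ^+ (n - m) * qbinom n m.
Proof. by []. Qed.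

Lemma qbinom0 n : qbinom n 0 = 1. Proof. by case: n. Qed.

Lemma qbinom_small n m : (n < m)%N -> qbinom n m = 0.
Proof.
elim: n m => [|n IH] [|m]//; rewrite ltnS => nm.
by rewrite qbinomS !IH ?mulr0 ?addr0// ltnW.
Qed.

(** The q-Pochhammer symbol (x; x)_n. *)
Definition qpoch n := \prod_(1 <= m < n.+1) (1 - x ^+ m).

Lemma qpochS n : qpoch n.+1 = qpoch n * (1 - x ^+ n.+1).
Proof. by rewrite /qpoch big_nat_recr. Qed.

(** The quotient formula with denominators cleared. Its inductive step is the Pascal rule with 1 -
    x^(n+1) = (1 - x^(n-m)) + x^(n-m) (1 - x^(m+1)). *)
Lemma qbinom_qpoch n m : (m <= n)%N ->
  qbinom n m * (qpoch m * qpoch (n - m)) = qpoch n.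
Proof.
elim: n m => [|n IH] [|m]; rewrite ?qbinom0 ?subn0 ?mul1r//.
- by rewrite /qpoch big_geq// mul1r.
- by rewrite {1}/qpoch big_geq// mul1r.
rewrite ltnS subSS leq_eqVlt => /predU1P[->|mn].
  rewrite qbinomS qbinom_small// add0r subnn mul1r.
  have := IH n (leqnn n); rewrite subnn qpochS => {2}<-.
  ring.
have E1 := IH _ mn; have E0 := IH _ (ltnW mn).
have Dn : (n - m = (n - m.+1).+1)%N by lia.
have En : x ^+ n.+1 = x ^+ (n - m) * x ^+ m.+1.
  by rewrite -exprD; congr (_ ^+ _); lia.
have {}E1 : qbinom n m.+1 * (qpoch m.+1 * qpoch (n - m))
    = qpoch n * (1 - x ^+ (n - m)).
  by rewrite -E1 {1}Dn [qpoch (_ - _).+1]qpochS -Dn; ring.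
have {}E0 : qbinom n m * (qpoch m.+1 * qpoch (n - m))
    = qpoch n * (1 - x ^+ m.+1) by rewrite -E0 qpochS; ring.
by rewrite qbinomS mulrDl -mulrA E1 E0 qpochS En; ring.
Qed.

(** The q-binomial theorem. In the induction the powers of x match by C(i+1, 2) = C(i, 2) + i and
    x^n = x^i x^(n-i); for i > n both binomials involved vanish. *)
Lemma coef_qbinomial n i :
  (\prod_(j < n) (1 - x ^+ j *: 'X))`_i
  = (-1) ^+ i * x ^+ 'C(i, 2) * qbinom n i.
Proof.
elim: n i => [|n IH] i.
  rewrite big_ord0 coef1; case: i => [|i]; last by rewrite mulr0.
  by rewrite !mul1r.
rewrite big_ord_recr /= mulrBr mulr1 -scalerAr coefB coefZ coefMX.
case: i => [|i] /=; first by rewrite mulr0 subr0 IH !qbinom0.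
rewrite !IH qbinomS binS bin1 exprD exprS.
have [ni|ni] := ltnP n i; first by rewrite !qbinom_small ?(leqW ni)//; ring.
have -> : x ^+ n = x ^+ i * x ^+ (n - i) by rewrite -exprD subnKC.
ring.
Qed.

Lemma mul_horner_deriv (p : {poly R}) m y : (size p <= m)%N ->
  y * p^`().[y] = \sum_(i < m) i%:R * p`_i * y ^+ i.
Proof.
move=> pm; have {1}-> : p = \poly_(i < m) p`_i.
  apply/polyP => i; rewrite coef_poly; case: ltnP => // mi.
  by rewrite nth_default// (leq_trans pm).
rewrite poly_def raddf_sum/= horner_sum mulr_sumr; apply: eq_bigr => i _.
rewrite derivZ derivXn hornerZ hornerMn hornerXn.
case: (nat_of_ord i) => [|k]; first by rewrite mulr0n !mulr0 !mul0r.
by rewrite exprS -mulr_natl; move: k.+1%:R => c; ring.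
Qed.

Hypothesis Ux : exists y, x * y = 1.

(* Evaluate at the root y = x^-n of G = prod_(j <= 2n) (1 - x^j X) both the
   product form and the q-binomial expansion of y G'(y); the terms of index
   n+1+m and n-m of the latter carry the same power of x. *)
Lemma finite_jacobi n :
  qpoch n ^+ 2 = \sum_(m < n.+1) (-1) ^+ m * x ^+ 'C(m.+1, 2)
    * ((n.+1 + m)%:R * qbinom n.*2.+1 (n.+1 + m)
        - (n - m)%:R * qbinom n.*2.+1 (n - m)).
Proof.
have [x' xx'] := Ux; pose y := x' ^+ n.
have xy k : x ^+ k * x' ^+ k = 1 by rewrite -exprMn xx' expr1n.
pose G := \prod_(j < n + n.+1) (1 - x ^+ j *: 'X).
have sG : (size G <= n.+1 + n.+1)%N.
  rewrite addSn /G; elim: (n + n.+1)%N => [|k IH].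
    by rewrite big_ord0 size_poly1.
  rewrite big_ord_recr/=; apply: (leq_trans (size_polyMleq _ _)).
  rewrite -subn1 leq_subLR.
  apply: leq_trans (leq_add IH (_ : _ <= 2)%N) _; last by lia.
  apply/leq_sizeP => -[|[|j]]// _.
  by rewrite coefB coef1 coefZ coefX mulr0 subr0.
(* The factor of index n vanishes at y, so only the term that differentiates it survives. *)
have E1 : y * G^`().[y] * x ^+ 'C(n.+1, 2) = (-1) ^+ n.+1 * qpoch n ^+ 2.
  rewrite /G big_split_ord/= big_ord_recl/= addn0.
  set H1 := \prod_(i < n) _; set H2 := \prod_(i < n) _.
  (* Each factor 1 - x^i y is - x^-(n-i) (1 - x^(n-i)); the power of x clears these denominators,
     whose exponents sum to C(n+1, 2). *)
  have H1y : H1.[y] * x ^+ 'C(n.+1, 2) = (-1) ^+ n * qpoch n.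
    rewrite /qpoch big_add1 big_mkord (reindex_inj rev_ord_inj)/=.
    have -> : 'C(n.+1, 2) = (\sum_(i < n) i.+1)%N.
      by rewrite -bin2_sum big_mkord big_ord_recl/= add0n.
    rewrite /H1 horner_prod.
    have -> : x ^+ (\sum_(i < n) i.+1) = \prod_(i < n) x ^+ i.+1.
      exact: (big_morph (fun k => x ^+ k) (exprD x) (expr0 x)).
    rewrite [X in _ * X](reindex_inj rev_ord_inj)/= -big_split/=.
    have -> : (-1) ^+ n = \prod_(i < n) (-1 : R) by rewrite prodr_const card_ord.
    rewrite -big_split.
    apply: eq_bigr => -[i /= i_n] _; rewrite !hornerE subnSK//.
    have -> : y = x' ^+ i * x' ^+ (n - i) by rewrite -exprD subnKC// ltnW.
    by ring: (xy i) (xy (n - i)%N).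
  have H2y : H2.[y] = qpoch n.
    have -> : H2 = \prod_(i < n) (1 - x ^+ (n + i.+1) *: 'X) by apply: eq_bigr.
    rewrite horner_prod /qpoch big_add1 big_mkord; apply: eq_bigr => i _.
    by rewrite !hornerE exprD mulrAC xy mul1r.
  have -> : y * (H1 * ((1 - x ^+ n *: 'X) * H2))^`().[y] = - (H1.[y] * H2.[y]).
    have y1 : x ^+ n * y = 1 by [].
    rewrite !derivM -polyC1 derivB derivC derivZ derivX sub0r.
    rewrite !(hornerM, hornerD, hornerN, hornerZ, hornerX, hornerC).
    by ring: y1.
  by rewrite mulNr mulrAC H1y H2y exprS; ring.
(* The condition on m reads C(i, 2) - n i + C(n+1, 2) = C(m+1, 2); it holds both for i = n - m and
   for i = n + 1 + m. *)
have Gn i : (i <= n.*2.+1)%N -> forall m,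
    ('C(i, 2) + 'C(n.+1, 2) = n * i + 'C(m.+1, 2))%N ->
  G`_i * (y ^+ i * x ^+ 'C(n.+1, 2))
    = (-1) ^+ i * x ^+ 'C(m.+1, 2) * qbinom n.*2.+1 i.
  move=> i_n m /(congr1 (fun k => x ^+ k)); rewrite !exprD exprM => Em.
  rewrite coef_qbinomial -addnn addnS.
  have Yi : (x ^+ n) ^+ i * y ^+ i = 1 by rewrite -exprMn xy expr1n.
  by ring: Em Yi.
apply: (can_inj (signrMK n.+1)); rewrite -E1.
rewrite (mul_horner_deriv y sG) big_split_ord/=.
rewrite (reindex_inj rev_ord_inj)/= -big_split/= big_distrl big_distrr/=.
apply: eq_bigr => -[m /= mn] _.
rewrite mulrDl -!mulrA.
rewrite (Gn (n.+1 - m.+1)%N _ m); [|lia|]; last first.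
  have := bin2_sqr (n.+1 - m.+1)%N; have := bin2_sqr m.+1.
  by have := bin2_sqr n.+1; nia.
rewrite (Gn (n.+1 + m)%N _ m); [|lia|]; last first.
  have := bin2_sqr (n.+1 + m)%N; have := bin2_sqr m.+1.
  by have := bin2_sqr n.+1; nia.
have -> : (-1) ^+ (n.+1 - m.+1) = - (-1) ^+ n.+1 * (-1) ^+ m :> R.
  by rewrite subSS -signr_odd oddB// signr_addb !signr_odd exprS; ring.
rewrite subSS exprD.
ring.
Qed.
End FiniteJacobi.

(** * Congruences modulo powers of q *)

Section Congruence.
Variable R : comNzRingType.
Implicit Types (f g h : laurent R) (m n : int).

Lemma vanishesD f g n :
  vanishes_below f n -> vanishes_below g n -> vanishes_below (f + g) n.
Proof. by move=> fn gn i ni; rewrite coefDl fn ?gn ?addr0. Qed.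

Lemma vanishesN f n : vanishes_below f n -> vanishes_below (- f) n.
Proof. by move=> fn i ni; rewrite coefNl fn ?oppr0. Qed.

Lemma vanishes_qvarX m : vanishes_below (qvar R ^ m) m.
Proof. by move=> n nm; rewrite coef_qvarX lt_eqF. Qed.

Lemma vanishesMl f g n :
  vanishes_below f 0 -> vanishes_below g n -> vanishes_below (f * g) n.
Proof. by move=> f0 gn; rewrite -[n]add0r; apply: vanishesM. Qed.

Lemma vanishes1 : vanishes_below (1 : laurent R) 0.
Proof. by rewrite -[1](expr0z (qvar R)); apply: vanishes_qvarX. Qed.

Lemma vanishes_natr k : vanishes_below (k%:R : laurent R) 0.
Proof.
elim: k => [|k IH]; first by move=> i _; rewrite coef0l.
by rewrite mulrS; apply: vanishesD => //; apply: vanishes1.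
Qed.

Lemma vanishesX0 f k : vanishes_below f 0 -> vanishes_below (f ^+ k) 0.
Proof. by move=> /vanishesX -/(_ k); rewrite mul0rn. Qed.

Definition eqmodq n f g := vanishes_below (f - g) n.

Lemma eqmodqP f g : (forall n, eqmodq n f g) -> f = g.
Proof.
move=> fg; apply/subr0_eq/laurentP => n.
by rewrite (fg (n + 1)) ?coef0l// ltrDl.
Qed.

Lemma eqmodqW m n f g : eqmodq n f g -> m <= n -> eqmodq m f g.
Proof. exact: vanishesW. Qed.

Lemma eqmodq_refl n f : eqmodq n f f.
Proof. by move=> i _; rewrite subrr coef0l. Qed.

Lemma eqmodq_sym n f g : eqmodq n f g -> eqmodq n g f.
Proof. by move=> /vanishesN; rewrite opprB. Qed.

Lemma eqmodq_trans n f g h : eqmodq n f g -> eqmodq n g h -> eqmodq n f h.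
Proof. by move=> fg /(vanishesD fg); rewrite addrA subrK. Qed.

Lemma eqmodqD n f f' g g' :
  eqmodq n f f' -> eqmodq n g g' -> eqmodq n (f + g) (f' + g').
Proof. by move=> ff' gg'; rewrite /eqmodq opprD addrACA; apply: vanishesD. Qed.

Lemma eqmodqN n f g : eqmodq n f g -> eqmodq n (- f) (- g).
Proof. by move=> /vanishesN; rewrite opprD. Qed.

Lemma eqmodq_sum n (I : finType) (F G : I -> laurent R) :
  (forall i, eqmodq n (F i) (G i)) -> eqmodq n (\sum_i F i) (\sum_i G i).
Proof.
by move=> FG; apply: (big_ind2 (eqmodq n)) => // *;
  [apply: eqmodq_refl | apply: eqmodqD].
Qed.

Lemma eqmodqMl n h f g :
  vanishes_below h 0 -> eqmodq n f g -> eqmodq n (h * f) (h * g).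
Proof. by move=> h0 fg; rewrite /eqmodq -mulrBr; apply: vanishesMl. Qed.

Lemma eqmodqM n f f' g g' : vanishes_below f' 0 -> vanishes_below g 0 ->
  eqmodq n f f' -> eqmodq n g g' -> eqmodq n (f * g) (f' * g').
Proof.
move=> f'0 g0 ff' gg'; apply: (eqmodq_trans (g := f' * g)).
  by rewrite ![_ * g]mulrC; apply: eqmodqMl.
exact: eqmodqMl.
Qed.

Lemma eqmodqX n k f g : vanishes_below f 0 -> vanishes_below g 0 ->
  eqmodq n f g -> eqmodq n (f ^+ k) (g ^+ k).
Proof.
move=> f0 g0 fg; elim: k => [|k IH]; first exact: eqmodq_refl.
by rewrite !exprS; apply: eqmodqM => //; apply: vanishesX0.
Qed.

End Congruence.

(** * Trisection of f_1^3 *)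

Lemma coef_intrM (c : int) (f : laurent int) n : (c%:~R * f) n = c * f n.
Proof.
have cM (k : nat) : (f *+ k) n = f n *+ k.
  by elim: k => [|k IH]; rewrite ?coef0l// !mulrSr coefDl IH.
rewrite mulrzl -[in RHS](intz c) mulrzl; case: c => k; first exact: cM.
by rewrite NegzE !mulrNz coefNl; congr (- _); apply: cM.
Qed.

Lemma vanishes_euler t : vanishes_below (euler t) 0.
Proof. exact: vanishes_lseries. Qed.

Lemma euler_partial_eqmodq t (N : nat) : (0 < t)%N ->
  eqmodq (N%:Z + 1) (euler t) (euler_partial t N).
Proof.
move=> t0 n nN; rewrite coefDl coefNl.
have [n0|n0] := ltP n 0.
  by rewrite vanishes_euler// vanishes_euler_partial// subr0.
have -> : n = `|n|%N by lia.
by rewrite (coef_eulerE (N := N))// ?subrr//; lia.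
Qed.

Lemma qpoch_euler n : qpoch 'q n = euler_partial 1 n.
Proof. by apply: eq_bigr => i _; rewrite muln1. Qed.

Lemma vanishes_qbinom n k : vanishes_below (qbinom 'q n k) 0.
Proof.
elim: n k => [|n IH] [|k]; rewrite ?qbinom0; try exact: vanishes1.
  by move=> i _; rewrite coef0l.
rewrite qbinomS; apply: vanishesD => //; apply: vanishesMl => //.
exact: (vanishesW (@vanishes_qvarX _ (n - k)%N)).
Qed.

(** All partial products in [qbinom_qpoch] have at least K - 1 factors, hence agree with f_1 modulo
    q^K; one f_1 is then cancelled by its power series inverse. *)
Lemma qbinom_eqmodq (n k : nat) (K : int) :
    (k <= n)%N -> K <= k%:Z + 1 -> K <= (n - k)%N%:Z + 1 ->
  eqmodq K (qbinom 'q n k * euler 1) 1.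
Proof.
move=> kn Kk Knk; have [g g0 eg] := euler_inverse (isT : (0 < 1)%N).
have P m : K <= m%:Z + 1 -> eqmodq K (euler 1) (euler_partial 1 m).
  by apply: eqmodqW; apply: euler_partial_eqmodq.
have e0 := @vanishes_euler 1; have B0 := @vanishes_qbinom n k.
have /(eqmodqMl g0) : eqmodq K (qbinom 'q n k * (euler 1 * euler 1)) (euler 1).
  apply: (@eqmodq_trans _ _ _ (euler_partial 1 n)).
    rewrite -qpoch_euler -(qbinom_qpoch 'q kn) !qpoch_euler.
    apply: eqmodqMl => //; apply: eqmodqM => //; last exact: P.
      exact: vanishes_euler_partial.
    exact: P.
  by apply: eqmodq_sym; apply: P; lia.
have -> : g * (qbinom 'q n k * (euler 1 * euler 1))
    = qbinom 'q n k * euler 1 * (euler 1 * g) by ring.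
by rewrite (mulrC g) eg mulr1.
Qed.

(** This is [finite_jacobi] times f_1: each Gaussian binomial times f_1 becomes 1, and the bracket
    becomes (n+1+m) - (n-m) = 2m+1. The precision m lost there is regained from q^C(m+1, 2), as
    C(m+1, 2) >= m. *)
Lemma jacobi_eqmodq (n : nat) :
  eqmodq (n%:Z + 1) (euler 1 ^+ 3)
    (\sum_(m < n.+1) (-1) ^+ m * 'q ^ 'C(m.+1, 2)%:Z * m.*2.+1%:R).
Proof.
have e0 := @vanishes_euler 1.
apply: (@eqmodq_trans _ _ _ (euler_partial 1 n ^+ 2 * euler 1)).
  have P0 := @vanishes_euler_partial 1 n.
  rewrite exprSr; apply: eqmodqM => //; last exact: eqmodq_refl.
    exact: vanishesX0.
  by apply: eqmodqX => //; apply: euler_partial_eqmodq.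
rewrite -qpoch_euler finite_jacobi; last first.
  by exists 'q^-1; rewrite mulrV// qvar_unit.
rewrite mulr_suml; apply: eqmodq_sum => -[m /= mn].
have B k : (k = n.+1 + m \/ k = n - m)%N ->
    eqmodq (n%:Z + 1 - m%:Z) (qbinom 'q n.*2.+1 k * euler 1) 1.
  by move=> kE; apply: qbinom_eqmodq; lia.
have Bm : eqmodq (n%:Z + 1 - m%:Z)
    ((n.+1 + m)%:R * (qbinom 'q n.*2.+1 (n.+1 + m) * euler 1)
      - (n - m)%:R * (qbinom 'q n.*2.+1 (n - m) * euler 1)) m.*2.+1%:R.
  have -> : m.*2.+1%:R = (n.+1 + m)%:R * 1 - (n - m)%:R * 1 :> laurent int.
    by rewrite !mulr1 -natrB; [congr (_%:R)|]; lia.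
  apply: eqmodqD; last apply: eqmodqN; apply: eqmodqMl.
  - exact: vanishes_natr.
  - by apply: B; left.
  - exact: vanishes_natr.
  - by apply: B; right.
rewrite /eqmodq; set X := (X in _ * X * _ - _); set Y := m.*2.+1%:R in Bm *.
have -> : (-1) ^+ m * 'q ^+ 'C(m.+1, 2) * X * euler 1
      - (-1) ^+ m * 'q ^ 'C(m.+1, 2)%:Z * Y
    = (-1) ^+ m * ('q ^ 'C(m.+1, 2)%:Z * (X * euler 1 - Y)).
  by rewrite -exprnP; ring.
apply: vanishesMl; first by apply/vanishesX0/vanishesN/vanishes1.
apply: (vanishesW (vanishesM (@vanishes_qvarX _ _) (_ : vanishes_below _ _))).
  by rewrite /X mulrBl -!mulrA; apply: Bm.
by rewrite binS bin1; lia.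
Qed.

Lemma coef_euler_cube (x : int) (n : nat) : x < n%:Z ->
  (euler 1 ^+ 3) x
  = \sum_(m < n) (-1) ^+ m * m.*2.+1%:R *+ (x == 'C(m.+1, 2)%:Z).
Proof.
case: n => [|n] xn; first by rewrite big_ord0 (vanishesX0 _ (@vanishes_euler 1)).
have := @jacobi_eqmodq n; move=> /(_ x); rewrite coefDl coefNl => /(_ _)/subr0_eq->.
  rewrite coef_suml; apply: eq_bigr => m _.
  have -> : (-1) ^+ m * 'q ^ 'C(m.+1, 2)%:Z * m.*2.+1%:R
      = ((-1) ^+ m * m.*2.+1%:R)%:~R * 'q ^ 'C(m.+1, 2)%:Z :> laurent int.
    by rewrite rmorphM rmorphXn rmorphN1 rmorph_nat mulrAC.
  by rewrite coef_intrM coef_qvarX [LHS]mulr_natr.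
lia.
Qed.

Lemma bin2_triple j : 'C((3 * j).+2, 2) = ('C(j.+1, 2) * 9 + 1)%N.
Proof.
have := bin2_sqr (3 * j).+2; have := bin2_sqr j.+1; nia.
Qed.

(** The summation index is split into 3j, 3j+1 and 3j+2, whose triangular numbers are 0, 1 and 0
    modulo 3. *)
Lemma coef_euler_cube3 (x : int) (n : nat) : x < (3 * n)%N%:Z ->
  (euler 1 ^+ 3) x
  = \sum_(j < n) ((-1) ^+ j * (6 * j).+1%:R *+ (x == ('C(j.+1, 2) * 9 - 3 * j)%N%:Z)
      - (-1) ^+ j * (6 * j).+3%:R *+ (x == ('C(j.+1, 2) * 9 + 1)%N%:Z)
      + (-1) ^+ j * (6 * j + 5)%:R *+ (x == ('C(j.+1, 2) * 9 + 3 * j + 3)%N%:Z)).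
Proof.
move=> xn; rewrite (coef_euler_cube xn).
rewrite (big_ord3 (fun m => (-1) ^+ m * m.*2.+1%:R *+ (x == 'C(m.+1, 2)%:Z))).
apply: eq_bigr => j _; have B := bin2_triple j.
have B0 : ('C((3 * j).+1, 2) = 'C(j.+1, 2) * 9 - 3 * j)%N.
  by move: B; rewrite binS bin1; lia.
rewrite B0 B (binS _.+2) B bin1.
have S3 : (-1) ^+ (3 * j) = (-1) ^+ j :> int by rewrite exprM.
congr (_ + _ + _).
- by rewrite S3; congr (_ * _%:R *+ _); lia.
- by rewrite exprS S3 mulN1r mulNr mulNrn; congr (- (_ * _%:R *+ _)); lia.
- by rewrite !exprS S3 !mulN1r opprK; congr (_ * _%:R *+ (_ == _%:Z)); lia.
Qed.

(** Exponents 1 modulo 3 come from the indices 3j+1 alone. There the exponent is 9 C(j+1, 2) + 1 and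
    the coefficient -3 (-1)^j (2j+1), so Jacobi's series recurs in q^3. *)
Lemma trisect_euler_cube1 :
  trisect ('q ^ (-1) * euler 1 ^+ 3) = - 3%:R * cube (euler 1 ^+ 3).
Proof.
apply/laurentP => n; rewrite trisectE coef_qvarXM.
pose N := `|(9 * n)%R|.+2%N.
have -> : - 3%:R = (- 3%:R)%:~R :> laurent int by rewrite rmorphN rmorph_nat.
have nN : 3 * n - -1 < (3 * N)%N%:Z by rewrite /N; lia.
rewrite [RHS]coef_intrM (coef_euler_cube3 nN).
have [/dvdzP[m nm]|n3] := boolP (3 %| n)%Z.
  rewrite nm [m * 3]mulrC cubeE [X in _ = _ * X](coef_euler_cube (n := N));
    last by rewrite /N; lia.
  rewrite mulr_sumr; apply: eq_bigr => j _.
  rewrite [_ == ('C(_, 2) * 9 - 3 * j)%N%:Z](_ : _ = false);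
    last by apply/eqP; lia.
  rewrite [_ == ('C(_, 2) * 9 + 3 * j + 3)%N%:Z](_ : _ = false);
    last by apply/eqP; lia.
  rewrite sub0r addr0.
  have -> : (3 * (3 * m) - -1 == ('C(j.+1, 2) * 9 + 1)%N)
     = (m == 'C(j.+1, 2)) by lia.
  have -> : (6 * j).+3 = (3 * j.*2.+1)%N by lia.
  by rewrite [RHS]mulrnAr -[LHS]mulNrn natrM mulrCA mulNr.
rewrite cube_ndvd// mulr0 big1// => j _.
rewrite [_ == ('C(_, 2) * 9 - 3 * j)%N%:Z](_ : _ = false);
  last by apply/eqP; lia.
rewrite [_ == ('C(_, 2) * 9 + 1)%N%:Z](_ : _ = false);
  last by apply/eqP; lia.
rewrite [_ == ('C(_, 2) * 9 + 3 * j + 3)%N%:Z](_ : _ = false);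
  last by apply/eqP; lia.
by rewrite subr0 addr0.
Qed.

(** No triangular number is 2 modulo 3. *)
Lemma trisect_euler_cube2 : trisect ('q ^ (-2) * euler 1 ^+ 3) = 0.
Proof.
apply/laurentP => n; rewrite trisectE coef_qvarXM coef0l.
have nN : 3 * n - -2 < (3 * `|(3 * n)%R|.+3)%N%:Z by lia.
rewrite (coef_euler_cube3 nN) big1// => j _.
rewrite [_ == ('C(_, 2) * 9 - 3 * j)%N%:Z](_ : _ = false);
  last by apply/eqP; lia.
rewrite [_ == ('C(_, 2) * 9 + 1)%N%:Z](_ : _ = false);
  last by apply/eqP; lia.
rewrite [_ == ('C(_, 2) * 9 + 3 * j + 3)%N%:Z](_ : _ = false);
  last by apply/eqP; lia.
by rewrite subr0 addr0.
Qed.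

(** * The norm to the series in q^3 *)

Section Norm.
Variable R : comNzRingType.
Implicit Types (f g h a b c : laurent R).
Local Notation q := (qvar R).

(* The norm of a(q^3) + q b(q^3) + q^2 c(q^3), with q^3 renamed to q. *)
Definition norm3 a b c :=
  a ^+ 3 + q * b ^+ 3 + q ^+ 2 * c ^+ 3 - 3%:R * q * a * b * c.

Definition norm f :=
  norm3 (trisect f) (trisect (q ^ (-1) * f)) (trisect (q ^ (-2) * f)).

Lemma norm_comp a b c :
  norm (cube a + q * cube b + q ^+ 2 * cube c) = norm3 a b c.
Proof. by rewrite /norm trisect_comp0 trisect_comp1 trisect_comp2. Qed.

(** In the basis 1, q, q^2 the powers q^3 and q^4 of a product fold back into the coefficients. A
    polynomial identity remains, [norm3] being the determinant of multiplication. *)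
Lemma normM f g : norm (f * g) = norm f * norm g.
Proof.
rewrite {1}[f]trisection {1}[g]trisection /norm.
move: (trisect f) (trisect (q ^ (-1) * f)) (trisect (q ^ (-2) * f)).
move: (trisect g) (trisect (q ^ (-1) * g)) (trisect (q ^ (-2) * g)).
move=> a' b' c' a b c; rewrite -/(norm _).
have -> : (cube a + q * cube b + q ^+ 2 * cube c)
      * (cube a' + q * cube b' + q ^+ 2 * cube c')
    = cube (a * a' + q * (b * c' + c * b'))
      + q * cube (a * b' + b * a' + q * (c * c'))
      + q ^+ 2 * cube (a * c' + b * b' + c * a').
  by rewrite !(rmorphD, rmorphM)/= cube_qvar; ring.
by rewrite norm_comp /norm3; ring.
Qed.

Lemma norm1 : norm 1 = 1.
Proof.
have -> : 1 = cube 1 + q * cube 0 + q ^+ 2 * cube 0 :> laurent R.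
  by rewrite rmorph1 rmorph0; ring.
by rewrite norm_comp /norm3; ring.
Qed.

Lemma normX f k : norm (f ^+ k) = norm f ^+ k.
Proof. by elim: k => [|k IH]; rewrite ?norm1// !exprS normM IH. Qed.

Lemma norm_1Xn3 k : norm (1 - q ^+ (3 * k)) = (1 - q ^+ k) ^+ 3.
Proof.
have -> : 1 - q ^+ (3 * k) = cube (1 - q ^+ k) + q * cube 0 + q ^+ 2 * cube 0.
  by rewrite !rmorphB rmorph1 rmorphXn/= cube_qvar -exprM; ring.
by rewrite norm_comp /norm3; ring.
Qed.

(** If 3 does not divide m, the conjugates 1 - (w q)^m over the cube roots of unity w multiply to 1
    - q^(3m), and renaming q^3 to q leaves 1 - q^m. Here this is read off the components. *)
Lemma norm_1Xn31 k : norm (1 - q ^+ (3 * k).+1) = 1 - q ^+ (3 * k).+1.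
Proof.
have {1}-> : 1 - q ^+ (3 * k).+1
    = cube 1 + q * cube (- q ^+ k) + q ^+ 2 * cube 0.
  by rewrite rmorphN rmorph1 rmorph0 rmorphXn/= cube_qvar -exprM exprS; ring.
have -> : q ^+ (3 * k).+1 = q * (q ^+ k) ^+ 3 by rewrite exprS mulnC exprM.
by rewrite norm_comp /norm3; ring.
Qed.

Lemma norm_1Xn32 k : norm (1 - q ^+ (3 * k).+2) = 1 - q ^+ (3 * k).+2.
Proof.
have {1}-> : 1 - q ^+ (3 * k).+2
    = cube 1 + q * cube 0 + q ^+ 2 * cube (- q ^+ k).
  by rewrite rmorphN rmorph1 rmorph0 rmorphXn/= cube_qvar -exprM !exprS; ring.
have -> : q ^+ (3 * k).+2 = q ^+ 2 * (q ^+ k) ^+ 3.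
  by rewrite -addn2 exprD mulnC exprM mulrC.
by rewrite norm_comp /norm3; ring.
Qed.

Lemma trisect_eqmodq (K e : int) f g : 0 <= e <= 2 -> eqmodq (3 * K) f g ->
  eqmodq K (trisect (q ^ (- e) * f)) (trisect (q ^ (- e) * g)).
Proof.
move=> e2 fg n nK; rewrite -raddfB -mulrBr.
rewrite -[LHS]/(trisect (q ^ (- e) * (f - g)) n) trisectE coef_qvarXM.
by apply: fg; lia.
Qed.

Lemma norm3_eqmodq (K : int) a a' b b' c c' :
    vanishes_below a 0 -> vanishes_below a' 0 -> vanishes_below b 0 ->
    vanishes_below b' 0 -> vanishes_below c 0 -> vanishes_below c' 0 ->
    eqmodq K a a' -> eqmodq K b b' -> eqmodq K c c' ->
  eqmodq K (norm3 a b c) (norm3 a' b' c').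
Proof.
move=> a0 a'0 b0 b'0 c0 c'0 aa bb cc.
have Vq k : vanishes_below (q ^+ k) 0 by exact: vanishesW (@vanishes_qvarX R k) _.
have Vx : vanishes_below (3%:R * q) 0.
  by apply: vanishesMl; [exact: vanishes_natr | exact: (Vq 1%N)].
have X3 (x y : laurent R) : vanishes_below x 0 -> vanishes_below y 0 -> eqmodq K x y ->
  eqmodq K (x ^+ 3) (y ^+ 3) by exact: eqmodqX.
have abc : eqmodq K (3%:R * q * a * b * c) (3%:R * q * a' * b' * c').
  apply: eqmodqM cc => //; first by apply: vanishesMl => //; apply: vanishesMl.
  apply: eqmodqM bb => //; first exact: vanishesMl.
  exact: eqmodqMl.
apply: eqmodqD (eqmodqN abc); apply: eqmodqD; first apply: eqmodqD.
- exact: X3.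
- by apply: eqmodqMl; [exact: (Vq 1%N) | exact: X3].
- by apply: eqmodqMl; [exact: Vq | exact: X3].
Qed.

(** The norm is a polynomial in the components, and components at precision K require the series at
    precision 3K. *)
Lemma norm_eqmodq (K : int) f g : vanishes_below f 0 -> vanishes_below g 0 ->
  eqmodq (3 * K) f g -> eqmodq K (norm f) (norm g).
Proof.
move=> f0 g0 fg; pose T (e : int) h := trisect (q ^ (- e) * h).
have T0 h e : vanishes_below h 0 -> 0 <= e <= 2 -> vanishes_below (T e h) 0.
  by move=> h0 e2 n n0; rewrite trisectE coef_qvarXM h0//; lia.
have TE h : trisect h = T 0 h by rewrite /T oppr0 expr0z mul1r.
rewrite /norm (TE f) (TE g) -/(T 1 f) -/(T 1 g) -/(T 2 f) -/(T 2 g).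
by apply: norm3_eqmodq; first [by apply: T0 | by apply: trisect_eqmodq].
Qed.

Lemma vanishes_norm f : vanishes_below f 0 -> vanishes_below (norm f) 0.
Proof.
move=> f0; have n0 : norm (0 : laurent R) = 0.
  by rewrite /norm !mulr0 !raddf0 /norm3; ring.
(* The claim is the congruence with the norm of 0 at K = 0. *)
rewrite -[norm f]subr0 -n0; apply: norm_eqmodq => //.
  by move=> n _; rewrite coef0l.
by rewrite /eqmodq mulr0 subr0.
Qed.
End Norm.

Lemma cube_euler_partial n : cube (euler_partial 1 n) = euler_partial 3 n.
Proof.
rewrite rmorph_prod; apply: eq_bigr => i _.
by rewrite rmorphB rmorph1 rmorphXn/= cube_qvar -exprM; congr (_ - _ ^+ _); lia.
Qed.

Lemma cube_eqmodq (R : comNzRingType) (K : int) (f g : laurent R) :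
  0 <= K -> eqmodq K f g -> eqmodq K (cube f) (cube g).
Proof.
move=> K0 /vanishes_cube; rewrite rmorphB => /vanishesW; apply; lia.
Qed.

Lemma cube_euler : cube (euler 1) = euler 3.
Proof.
apply: eqmodqP => K; apply: (eqmodqW (n := `|K| + 1)); last by lia.
apply: (eqmodq_trans (g := euler_partial 3 `|K|)).
  rewrite -cube_euler_partial; apply: cube_eqmodq; first by lia.
  exact: euler_partial_eqmodq.
exact/eqmodq_sym/euler_partial_eqmodq.
Qed.

(** Factors enter three at a time: those of index 3n+1 and 3n+2 are their own norms, index 3n+3
    gives (1 - q^(n+1))^3, and the [cube] on the left supplies 1 - q^(3n+3). *)
Lemma norm_euler_partial n :
  norm (euler_partial 1 (3 * n)) * cube (euler_partial 1 n)
  = euler_partial 1 (3 * n) * euler_partial 1 n ^+ 3.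
Proof.
elim: n => [|n IH].
  by rewrite muln0 /euler_partial big_geq// norm1 rmorph1 expr1n.
have -> : (3 * n.+1 = (3 * n).+3)%N by lia.
rewrite !euler_partialS !muln1 !normM norm_1Xn31 norm_1Xn32.
have -> : ((3 * n).+3 = 3 * n.+1)%N by lia.
rewrite norm_1Xn3 rmorphM rmorphB rmorph1 rmorphXn/= cube_qvar -exprM exprMn.
set e := euler_partial 1 (3 * n) in IH *; set u := 'q ^+ (3 * n).+1.
set v := 'q ^+ (3 * n).+2; set w := 'q ^+ (3 * n.+1); set z := 'q ^+ n.+1.
transitivity ((norm e * cube (euler_partial 1 n))
  * ((1 - u) * (1 - v) * (1 - z) ^+ 3 * (1 - w))); first by ring.
by rewrite IH; ring.
Qed.

Lemma norm_euler : norm (euler 1) * euler 3 = euler 1 ^+ 4.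
Proof.
apply: eqmodqP => K; pose n := `|K|%N; apply: (eqmodqW (n := n%:Z)); last by lia.
have E := vanishes_euler 1; have P m := @vanishes_euler_partial 1 m.
have En : eqmodq n%:Z (euler 1) (euler_partial 1 n).
  by apply: (eqmodqW (@euler_partial_eqmodq 1 n isT)); lia.
(* Three times as many factors are kept under the norm, which divides the precision by 3. *)
have E3n : eqmodq (3 * n%:Z) (euler 1) (euler_partial 1 (3 * n)).
  by apply: (eqmodqW (@euler_partial_eqmodq 1 (3 * n) isT)); lia.
apply: (@eqmodq_trans _ _ _
    (norm (euler_partial 1 (3 * n)) * cube (euler_partial 1 n))).
  rewrite -cube_euler; apply: eqmodqM.
  - exact: vanishes_norm.
  - exact: vanishesW (vanishes_cube E) _.
  - exact: norm_eqmodq.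
  - exact: cube_eqmodq.
rewrite norm_euler_partial [euler 1 ^+ 4]exprS; apply/eqmodq_sym/eqmodqM => //.
- exact: vanishesX0.
- by apply: (eqmodqW E3n); lia.
- exact: eqmodqX.
Qed.

(** * The modular equation *)

Section ModularEquation.
Variables t s a : laurent int.
Hypotheses (Ut : t \is a GRing.unit) (Us : s \is a GRing.unit).
Hypothesis cube_t : cube t = s.
Hypothesis t_trisection : t = cube a - 3%:R * 'q * cube s.
Hypothesis norm_t : s * (a ^+ 3 - 27%:R * 'q * s ^+ 3) = t ^+ 4.

Let Uq : 'q \is a GRing.unit := qvar_unit int.

Definition tau := 'q ^ (-1) * t ^ 4 * s ^ (-4).
Definition tau' := 'q * t ^ (-4) * s ^ 4.
Definition omega (e : int) := s ^ (- e) * trisect ('q ^ (- e) * t ^ e).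

Lemma tauK : tau * tau' = 1.
Proof.
rewrite /tau /tau'; transitivity
  (('q ^ (-1) * 'q ^ 1) * (t ^ 4 * t ^ (-4)) * (s ^ (-4) * s ^ 4)).
  by rewrite expr1z; ring.
by rewrite -!exprzDr// !addNr addrN !expr0z !mulr1.
Qed.

Lemma trisect_omega e : trisect ('q ^ (- e) * t ^ e) = s ^ e * omega e.
Proof. by rewrite /omega mulrA -exprzDr// addrN expr0z mul1r. Qed.

Lemma omega_rec e : omega (e + 3) =
  - 9%:R * omega (e + 2) - 27%:R * omega (e + 1) + tau * omega e.
Proof.
pose u := a ^+ 3 - 27%:R * 'q * s ^+ 3; pose qi := 'q^-1; pose si := s^-1.
have qqi : 'q * qi = 1 by rewrite mulrV.
have ssi : s * si = 1 by rewrite mulrV.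
(* The monic cubic, from the third power of a(q^3) = t + 3 q s(q^3). *)
have t3 : t ^+ 3 = cube (- 9%:R * s) * ('q * t ^+ 2)
    + cube (- 27%:R * s ^+ 2) * ('q ^+ 2 * t) + cube u.
  rewrite /u !(rmorphB, rmorphM, rmorphN, rmorphXn, rmorph_nat)/= cube_qvar.
  by rewrite t_trisection; ring.
have XV (x : laurent int) (k : nat) : x \is a GRing.unit ->
    x ^ (- (e + k%:Z)) = x ^ (- e) * x^-1 ^+ k.
  by move=> Ux; rewrite opprD exprzDr// -(exprz_inv x k).
have XD (k : nat) : t ^ (e + k%:Z) = t ^ e * t ^+ k by rewrite exprzDr.
(* U is applied to the cubic times q^-(e+3) t^e. *)
have w3 : trisect ('q ^ (- (e + 3)) * t ^ (e + 3)) =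
    - 9%:R * s * trisect ('q ^ (- (e + 2)) * t ^ (e + 2))
    + - 27%:R * s ^+ 2 * trisect ('q ^ (- (e + 1)) * t ^ (e + 1))
    + qi * u * trisect ('q ^ (- e) * t ^ e).
  rewrite -!trisectM -!raddfD /= !(XV 'q _ Uq) !XD; congr trisect.
  have cqi : cube qi = qi ^+ 3 by rewrite rmorphV//= cube_qvar exprVn.
  rewrite t3 [cube (qi * u)]rmorphM/= cqi -/qi.
  move: ('q ^ _) (t ^ _) (cube _) (cube _) (cube _) => A B C1 C2 C3.
  by ring: qqi.
rewrite /omega w3 !(XV s _ Us) -/si.
(* By [norm_t], t^4 = s u. *)
have -> : tau = qi * u * si ^+ 3.
  rewrite /tau -[t ^ 4]/(t ^+ 4) -norm_t -[s ^ (-4)]/((s ^+ 4)^-1) -exprVn -/u -/si.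
  by rewrite -[_ ^ (-1)]/qi; ring: ssi.
move: (s ^ _) (trisect _) (trisect _) (trisect _) => A B C1 C2.
by ring: ssi.
Qed.

Lemma omega0 : omega 0 = 1.
Proof.
rewrite /omega oppr0 !expr0z !mul1r -[1 in LHS](rmorph1 (@cube int)).
exact: trisect_cube.
Qed.

Lemma omega1 : omega 1 = - 3%:R.
Proof.
rewrite /omega expr1z t_trisection.
have -> : 'q ^ (-1) * (cube a - 3%:R * 'q * cube s)
    = 'q ^ (-1) * cube a + 'q ^ 0 * cube (- 3%:R * s).
  rewrite rmorphM rmorphN rmorph_nat/= -(addNr 1) exprzDr// expr1z; ring.
rewrite raddfD/= !trisect_qcube /= add0r expr0z mul1r mulrCA.
by rewrite mulVr// mulr1.
Qed.

(** In the square of the trisection of t, only 9 q^2 s(q^3)^2 has exponents 2 modulo 3. *)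
Lemma omega2 : omega 2 = 9%:R.
Proof.
rewrite /omega t_trisection.
have -> : 'q ^ (-2) * (cube a - 3%:R * 'q * cube s) ^ 2
    = 'q ^ (-2) * cube (a ^+ 2) + 'q ^ (-1) * cube (- 6%:R * a * s)
      + 'q ^ 0 * cube (9%:R * s ^+ 2).
  rewrite !(rmorphM, rmorphN, rmorphXn, rmorph_nat)/=.
  have -> : 'q ^ (-1) = 'q ^ (-2) * 'q by exact: (exprzDr Uq (-2) 1).
  have -> : 'q ^ 0 = 'q ^ (-2) * 'q ^+ 2 by exact: (exprzDr Uq (-2) 2).
  by rewrite -!exprnP; ring.
rewrite !raddfD/= !trisect_qcube /= !add0r expr0z mul1r mulrCA.
by rewrite mulVr ?unitrX// mulr1.
Qed.

(** The contributions -81 of [omega 2] and 81 of [omega 1] cancel. The lemmas up to [omega8]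
    continue the recurrence. *)
Lemma omega3 : omega 3 = tau.
Proof.
have := omega_rec 0; rewrite !add0r omega0 omega1 omega2 => ->.
by ring.
Qed.

Lemma omega4 : omega 4 = - 12%:R * tau - 243%:R.
Proof. by rewrite (omega_rec 1) omega1 omega2 omega3; ring. Qed.

Lemma omega5 : omega 5 = 90%:R * tau + 2187%:R.
Proof. by rewrite (omega_rec 2) omega2 omega3 omega4; ring. Qed.

Lemma omega6 : omega 6 = tau ^+ 2 - 486%:R * tau - 13122%:R.
Proof. by rewrite (omega_rec 3) omega3 omega4 omega5; ring. Qed.

Lemma omega7 :
  omega 7 = - 21%:R * tau ^+ 2 + 1701%:R * tau + 59049%:R.
Proof. by rewrite (omega_rec 4) omega4 omega5 omega6; ring. Qed.

Lemma omega8 : omega 8 = 252%:R * tau ^+ 2 - 177147%:R.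
Proof. by rewrite (omega_rec 5) omega5 omega6 omega7; ring. Qed.

(** The recurrence is read backwards, here and for [omega (-2)]. The powers of [tau] clear its
    negative powers and are those that [trisect_even] produces. *)
Lemma mul_tau_omegaN1 : tau * omega (-1) = 9%:R.
Proof.
have : omega 2 = _ := omega_rec (-1).
rewrite omega0 omega1 omega2 => E.
by rewrite -[RHS](addrK (27%:R - 27%:R)) {1}E; ring.
Qed.

Lemma mul_tau2_omegaN2 : tau ^+ 2 * omega (-2) = 6%:R * tau + 243%:R.
Proof.
have : omega 1 = _ := omega_rec (-2).
rewrite omega0 omega1 => E.
have -> : tau ^+ 2 * omega (-2) = tau * (- 3%:R + 9%:R) + 27%:R * (tau * omega (-1)).
  by rewrite E; ring.
by rewrite mul_tau_omegaN1; ring.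
Qed.

Lemma tauX i : tau ^+ i = 'q ^ (- i%:Z) * t ^ (4 * i%:Z) * s ^ (- (4 * i%:Z)).
Proof.
rewrite /tau exprMn [('q ^ _ * _) ^+ i]exprMn !(exprnP _ i) !exprz_exp.
by rewrite mulN1r mulNr.
Qed.

Lemma tau'X i : tau' ^+ i = 'q ^ i%:Z * t ^ (- (4 * i%:Z)) * s ^ (4 * i%:Z).
Proof.
rewrite /tau' exprMn [('q * _) ^+ i]exprMn !(exprnP _ i) !exprz_exp.
by rewrite mulNr.
Qed.

Lemma cube_tX n : cube (t ^ n) = s ^ n.
Proof.
case: n => n; first by rewrite -exprnP rmorphXn/= cube_t.
by rewrite NegzE -!exprnN rmorphV ?unitrX// rmorphXn/= cube_t.
Qed.

Lemma cube_qX n : cube ('q ^ n) = 'q ^ (3 * n).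
Proof.
rewrite -exprz_exp -exprnP.
case: n => n; first by rewrite -exprnP rmorphXn/= cube_qvar.
by rewrite NegzE -!exprnN rmorphV ?unitrX// rmorphXn/= cube_qvar.
Qed.

(** Since t^k tau'^i = q^i s^(4i) t^(k-4i), the series q^(-3i) s^(4i) in q^3 can be pulled out of U,
    leaving q^-e t^e with e = k - 4i. *)
Lemma trisect_even (k i : nat) :
  trisect ('q ^ (- k%:Z) * (t ^+ k * tau' ^+ i))
  = s ^+ k * (tau ^+ i * omega (k%:Z - 4 * i%:Z)).
Proof.
pose e : int := k%:Z - 4 * i%:Z.
have -> : 'q ^ (- k%:Z) * (t ^+ k * tau' ^+ i)
    = cube ('q ^ (- i%:Z) * t ^ (4 * i%:Z)) * ('q ^ (- e) * t ^ e).
  rewrite rmorphM/= cube_tX cube_qX tau'X.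
  transitivity (('q ^ (- k%:Z) * 'q ^ i%:Z) * (t ^ k%:Z * t ^ (- (4 * i%:Z)))
    * s ^ (4 * i%:Z)); first by rewrite -(exprnP t k); ring.
  transitivity (('q ^ (3 * - i%:Z) * 'q ^ (- e)) * t ^ e * s ^ (4 * i%:Z));
    last by ring.
  rewrite -(exprzDr Uq (- k%:Z)) -(exprzDr Uq (3 * _)) -(exprzDr Ut k%:Z).
  have -> : - k%:Z + i%:Z = 3 * - i%:Z + - e by rewrite /e; lia.
  by have -> : k%:Z + - (4 * i%:Z) = e by [].
rewrite trisectM trisect_omega -/e tauX.
have -> : s ^+ k = s ^ (4 * i%:Z) * s ^ e.
  by rewrite -(exprzDr Us (4 * _)) /e addrC subrK.
have : s ^ (4 * i%:Z) * s ^ (- (4 * i%:Z)) = 1 by rewrite -(exprzDr Us (4 * _)) addrN.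
move: (s ^ _) (s ^ (- _)) (s ^ e) => x y z xy.
by ring: xy.
Qed.

(** Since s^k tau^i = q^-i t^(4i) s^(k-4i), the series pulled out is q^(3i) s^(k-4i), leaving q^-j
    t^j with j = 4i. *)
Lemma trisect_odd (k i : nat) :
  trisect (s ^+ k * tau ^+ i) = t ^+ k * (tau' ^+ i * omega (4 * i%:Z)).
Proof.
pose e : int := k%:Z - 4 * i%:Z; pose j : int := 4 * i%:Z.
have -> : s ^+ k * tau ^+ i
    = cube ('q ^ i%:Z * t ^ e) * ('q ^ (- j) * t ^ j).
  rewrite rmorphM/= cube_tX cube_qX tauX -/j.
  transitivity ('q ^ (- i%:Z) * t ^ j * (s ^ k%:Z * s ^ (- j)));
    first by rewrite -(exprnP s k); ring.
  transitivity (('q ^ (3 * i%:Z) * 'q ^ (- j)) * t ^ j * s ^ e);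
    last by ring.
  rewrite -(exprzDr Us k%:Z) -(exprzDr Uq (3 * _)).
  have -> : - i%:Z = 3 * i%:Z + - j by rewrite /j; lia.
  by have -> : k%:Z + - j = e by [].
rewrite trisectM trisect_omega tau'X -/j.
have -> : t ^ e = t ^+ k * t ^ (- j) by rewrite exprnP -(exprzDr Ut k%:Z).
by ring.
Qed.

Lemma trisect_lincomb3 (c0 c1 c2 : int) (f0 f1 f2 : laurent int) :
  trisect (c0%:~R * f0 + c1%:~R * f1 + c2%:~R * f2)
  = c0%:~R * trisect f0 + c1%:~R * trisect f1 + c2%:~R * trisect f2.
Proof.
have E (c : int) (f : laurent int) : trisect (c%:~R * f) = c%:~R * trisect f.
  by rewrite -{1}(rmorph_int (@cube int) c) trisectM.
by rewrite -!E -!raddfD.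
Qed.

(** Three coordinates suffice, since k <= 8 gives floor(k/3) <= 2. *)
Definition even_comb (k : nat) (c0 c1 c2 : int) : laurent int :=
  t ^+ k * (c0%:~R + c1%:~R * tau' + c2%:~R * tau' ^+ 2).

Definition odd_comb (k : nat) (d0 d1 d2 : int) : laurent int :=
  s ^+ k * (d0%:~R + d1%:~R * tau + d2%:~R * tau ^+ 2).

Lemma trisect_even_comb k c0 c1 c2 d0 d1 d2 :
    c0%:~R * omega k%:Z + c1%:~R * (tau * omega (k%:Z - 4))
      + c2%:~R * (tau ^+ 2 * omega (k%:Z - 8))
    = d0%:~R + d1%:~R * tau + d2%:~R * tau ^+ 2 ->
  trisect ('q ^ (- k%:Z) * even_comb k c0 c1 c2) = odd_comb k d0 d1 d2.
Proof.
have L0 := trisect_even k 0; have L1 := trisect_even k 1.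
have L2 := trisect_even k 2; rewrite /odd_comb => <-.
rewrite mulr0 subr0 !expr0 mulr1 mul1r in L0; rewrite mulr1 !expr1 in L1.
have -> : 'q ^ (- k%:Z) * even_comb k c0 c1 c2
    = c0%:~R * ('q ^ (- k%:Z) * t ^+ k)
      + c1%:~R * ('q ^ (- k%:Z) * (t ^+ k * tau'))
      + c2%:~R * ('q ^ (- k%:Z) * (t ^+ k * tau' ^+ 2)).
  by rewrite /even_comb; move: ('q ^ _) => Q; ring.
rewrite trisect_lincomb3 L0 L1 L2.
by move: (omega _) (omega _) (omega _) => w0 w1 w2; ring.
Qed.

(** The columns of this matrix are [omega 0], tau' times [omega 4] and tau'^2 times [omega 8],
    expanded by tau tau' = 1. *)
Lemma trisect_odd_comb k d0 d1 d2 :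
  trisect (odd_comb k d0 d1 d2)
  = even_comb k (d0 - 12%:R * d1 + 252%:R * d2) (- 243%:R * d1)
      (- 177147%:R * d2).
Proof.
have L0 := trisect_odd k 0; have L1 := trisect_odd k 1.
have L2 := trisect_odd k 2; have K := tauK.
rewrite mulr0 !expr0 mulr1 mul1r omega0 mulr1 in L0.
rewrite mulr1 !expr1 omega4 in L1.
rewrite [4 * 2%:Z]/= omega8 in L2.
have -> : odd_comb k d0 d1 d2 = d0%:~R * s ^+ k + d1%:~R * (s ^+ k * tau)
    + d2%:~R * (s ^+ k * tau ^+ 2) by rewrite /odd_comb; ring.
rewrite trisect_lincomb3 L0 L1 L2 /even_comb.
move: tau tau' K => T T' K.
by ring: K.
Qed.
End ModularEquation.

(** * The modular equation for f_1^3 and f_3^3 *)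

Lemma cube_euler3 : cube (euler 1 ^+ 3) = euler 3 ^+ 3.
Proof. by rewrite rmorphXn/= cube_euler. Qed.

Lemma euler_cube_trisection : euler 1 ^+ 3 =
  cube (trisect (euler 1 ^+ 3)) - 3%:R * 'q * cube (euler 3 ^+ 3).
Proof.
have cubeN3 (f : laurent int) : cube (- 3%:R * f) = - 3%:R * cube f.
  by rewrite rmorphM rmorphN rmorph_nat.
rewrite {1}[euler 1 ^+ 3]trisection trisect_euler_cube1 trisect_euler_cube2.
rewrite cube_euler3 cubeN3 rmorph0.
by move: (cube _) (cube _) => a s; ring.
Qed.

(** The third power of [norm_euler], with the components b = -3 s and c = 0 of t put into the norm
    form. *)
Lemma norm_euler_cube : euler 3 ^+ 3
    * (trisect (euler 1 ^+ 3) ^+ 3 - 27%:R * 'q * (euler 3 ^+ 3) ^+ 3)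
  = (euler 1 ^+ 3) ^+ 4.
Proof.
have : norm (euler 1 ^+ 3) * euler 3 ^+ 3 = (euler 1 ^+ 3) ^+ 4.
  by rewrite normX -exprMn norm_euler -!exprM.
rewrite /norm trisect_euler_cube1 trisect_euler_cube2 cube_euler3 /norm3 => <-.
move: (trisect _) (euler 3 ^+ 3) => a s; ring.
Qed.

Lemma euler_cube_unit n : (0 < n)%N -> euler n ^+ 3 \is a GRing.unit.
Proof. by move=> n0; rewrite unitrX// euler_unit. Qed.

Lemma p_neg j n : n < 0 -> p j n = 0.
Proof. by move=> n0; rewrite /p (vanishesX0 _ (@vanishes_euler 1)). Qed.

(** * The two families of series *)

Definition offset (k b : nat) := (k * (3 ^ (2 * b) - 1) %/ 8)%N.

Lemma offsetE k b : (8 * offset k b = k * (3 ^ (2 * b) - 1))%N.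
Proof. by rewrite mulnC divnK// shift_dvd. Qed.

Lemma offsetS k b : offset k b.+1 = (offset k b + k * 3 ^ (2 * b))%N.
Proof.
have := offsetE k b; have := offsetE k b.+1.
rewrite mulnS expnD; have := expn_gt0 3 (2 * b).
move: (3 ^ (2 * b))%N => N; nia.
Qed.

(** This bound makes the lower summation limits of both families harmless: below them the argument
    of [p] is negative. *)
Lemma offset_lt k b : (k <= 8)%N -> (offset k b < 3 ^ (2 * b))%N.
Proof.
have := offsetE k b; have := expn_gt0 3 (2 * b).
move: (3 ^ (2 * b))%N => N; nia.
Qed.

Definition even_series (k b : nat) : laurent int :=
  lseries 0 (fun n => p (3 * k) ((3 ^ (2 * b))%N%:Z * n + (offset k b)%:Z)).

Definition odd_series (k b : nat) : laurent int :=
  lseries (- (k %/ 3)%N%:Z) (fun n =>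
    p (3 * k) ((3 ^ (2 * b + 1))%N%:Z * n + (offset k b.+1)%:Z)).

Lemma coef_even k b n : (k <= 8)%N ->
  even_series k b n = p (3 * k) ((3 ^ (2 * b))%N%:Z * n + (offset k b)%:Z).
Proof.
move=> k8; have := @offset_lt k b k8; rewrite /even_series /=; case: leP => // n0.
by move: (3 ^ _)%N => N oN; rewrite p_neg//; nia.
Qed.

(** By [offsetS] the argument of [p] regroups around 3n + k, which is negative exactly when n < -
    floor(k/3). *)
Lemma coef_odd k b n : (k <= 8)%N ->
  odd_series k b n =
  p (3 * k) ((3 ^ (2 * b))%N%:Z * (3 * n + k%:Z) + (offset k b)%:Z).
Proof.
move=> k8; have := @offset_lt k b k8; rewrite /odd_series /= offsetS expnD.
move: (3 ^ (2 * b))%N => N oN.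
case: leP => nk; first by congr (p _ _); lia.
have : 3 * n + k%:Z < 0 by lia.
by move: (3 * n + k%:Z) => x x0; rewrite p_neg//; nia.
Qed.

Lemma even_series0 k : even_series k 0 = euler 1 ^+ (3 * k).
Proof.
have v := vanishesX0 (3 * k) (@vanishes_euler 1).
apply/laurentP => n; rewrite /even_series /offset/= muln0 subnn muln0 div0n.
rewrite expn0 mul1r addr0 /p; by case: leP => // n0; rewrite v.
Qed.

Lemma odd_seriesE k b : (k <= 8)%N ->
  odd_series k b = trisect ('q ^ (- k%:Z) * even_series k b).
Proof.
move=> k8; apply/laurentP => n; rewrite trisectE coef_qvarXM.
by rewrite coef_odd// coef_even// opprK.
Qed.

Lemma even_seriesS k b : (k <= 8)%N ->
  even_series k b.+1 = trisect (odd_series k b).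
Proof.
move=> k8; apply/laurentP => n; rewrite trisectE coef_odd// coef_even//.
rewrite offsetS mulnS expnD; congr (p _ _).
by move: (3 ^ (2 * b))%N => N; lia.
Qed.

Local Notation t := (euler 1 ^+ 3).
Local Notation s := (euler 3 ^+ 3).

(* odd_step says that U(q^-k -) maps even_comb with coordinates c to odd_comb
   with coordinates d, and even_step that U maps odd_comb with coordinates d to
   even_comb with coordinates c (the constants are those of omega 4, omega 8). *)
Definition odd_step (k : nat) (c d : nat -> int) :=
  (c 0%N)%:~R * omega t s k%:Z + (c 1%N)%:~R * (tau t s * omega t s (k%:Z - 4))
    + (c 2%N)%:~R * (tau t s ^+ 2 * omega t s (k%:Z - 8))
  = (d 0%N)%:~R + (d 1%N)%:~R * tau t s + (d 2%N)%:~R * tau t s ^+ 2.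

Definition even_step (d c : nat -> int) :=
  [/\ c 0%N = d 0%N - 12%:R * d 1%N + 252%:R * d 2%N,
      c 1%N = - 243%:R * d 1%N & c 2%N = - 177147%:R * d 2%N].

Lemma series_comb k (c : nat -> nat -> int) : (k <= 8)%N ->
    c 0%N 0%N = 1 -> c 0%N 1%N = 0 -> c 0%N 2%N = 0 ->
    (forall b, odd_step k (c (2 * b)%N) (c (2 * b + 1)%N)) ->
    (forall b, even_step (c (2 * b + 1)%N) (c (2 * b.+1)%N)) ->
  forall b,
  even_series k b = even_comb t s k
    (c (2 * b)%N 0%N) (c (2 * b)%N 1%N) (c (2 * b)%N 2%N)
  /\ odd_series k b
      = odd_comb t s k (c (2 * b + 1)%N 0%N) (c (2 * b + 1)%N 1%N)
          (c (2 * b + 1)%N 2%N).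
Proof.
move=> k8 c0 c1 c2 c_odd c_even.
have Ut : t \is a GRing.unit by exact: euler_cube_unit.
have Us : s \is a GRing.unit by exact: euler_cube_unit.
have E b : even_series k b = even_comb t s k
    (c (2 * b)%N 0%N) (c (2 * b)%N 1%N) (c (2 * b)%N 2%N).
  elim: b => [|b IH].
    rewrite even_series0 /even_comb muln0 c0 c1 c2 exprM.
    by rewrite !mul0r !addr0 mulr1.
  rewrite even_seriesS// odd_seriesE// IH.
  rewrite (trisect_even_comb Ut Us cube_euler3 (c_odd b)).
  rewrite (trisect_odd_comb Ut Us cube_euler3 euler_cube_trisection
    norm_euler_cube).
  by have [-> -> ->] := c_even b.
move=> b; split=> //.
by rewrite odd_seriesE// E (trisect_even_comb Ut Us cube_euler3 (c_odd b)).
Qed.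

(** * Linear recurrences and the sequences C and D *)

Lemma rec2_eq (h r : int) (u v : nat -> int) :
    (forall b, u b.+2 = h * u b.+1 + r * u b) ->
    (forall b, v b.+2 = h * v b.+1 + r * v b) ->
  u 0 = v 0 -> u 1 = v 1 -> u =1 v.
Proof.
move=> uS vS uv0 uv1 b; suff [] : u b = v b /\ u b.+1 = v b.+1 by [].
by elim: b => // b [IH0 IH1]; rewrite uS vS IH0 IH1.
Qed.

Section LinearCombination.
Variables (h r : int) (d c0 c1 c2 : nat -> int) (x0 x1 x2 : int).
Variables (d0 d1 d2 d3 m0 m1 m2 m3 n0 n1 n2 n3 l0 l1 l2 l3 : int).
Hypotheses (hd : solves h r (d0, d1, d2, d3) d)
  (h0 : solves h r (m0, m1, m2, m3) c0) (h1 : solves h r (n0, n1, n2, n3) c1)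
  (h2 : solves h r (l0, l1, l2, l3) c2).

(** Along indices of one parity the recurrence has order two, so the relation need only be checked
    at b = 0 and b = 1. *)
Lemma odd_lincomb :
    d1 = x0 * m0 + x1 * n0 + x2 * l0 -> d3 = x0 * m2 + x1 * n2 + x2 * l2 ->
  forall b, d (2 * b + 1)%N
    = x0 * c0 (2 * b)%N + x1 * c1 (2 * b)%N + x2 * c2 (2 * b)%N.
Proof.
move: hd h0 h1 h2 => [_ <- _ <- Rd] [<- _ <- _ R0] [<- _ <- _ R1] [<- _ <- _ R2].
move=> E1 E3; apply: (rec2_eq (h := h) (r := r)) => // b.
  by rewrite !mulnS -addnA addn1 !addSn Rd addn1.
by rewrite !mulnS !addSn !add0n R0 R1 R2; ring.
Qed.

(** The same comparison shifted: d(2) and d(4) = h d(2) + r d(0) are matched with the terms of index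
    1 and 3 of the other sequences. *)
Lemma even_lincomb :
    d2 = x0 * m1 + x1 * n1 + x2 * l1 ->
    h * d2 + r * d0 = x0 * m3 + x1 * n3 + x2 * l3 ->
  forall b, d (2 * b.+1)%N
    = x0 * c0 (2 * b + 1)%N + x1 * c1 (2 * b + 1)%N + x2 * c2 (2 * b + 1)%N.
Proof.
move: hd h0 h1 h2 => [<- _ <- _ Rd] [_ <- _ <- R0] [_ <- _ <- R1] [_ <- _ <- R2].
rewrite -Rd => E1 E3; apply: (rec2_eq (h := h) (r := r)) => // b.
  by rewrite !mulnS !addSn !add0n Rd.
by rewrite !mulnS !addSn !add0n !addn1 R0 R1 R2; ring.
Qed.
End LinearCombination.

Lemma mul_exp_tau' (x y : laurent int) (k i : nat) : x \is a GRing.unit ->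
  (x ^+ 3) ^+ k * tau' (x ^+ 3) (y ^+ 3) ^+ i
  = 'q ^ i%:Z * x ^ ((3 * k)%N%:Z - (12 * i)%N%:Z) * y ^+ (12 * i).
Proof.
move=> Ux; rewrite tau'X !(exprnP _ 3) !exprz_exp (exprzDr Ux (3 * k)%N%:Z).
have -> : 3 * - (4 * i%:Z) = - (12 * i)%N%:Z by lia.
have -> : 3 * (4 * i%:Z) = (12 * i)%N%:Z by lia.
by rewrite -!exprnP -exprM; ring.
Qed.

Lemma mul_exp_tau (x y : laurent int) (k i : nat) : y \is a GRing.unit ->
  (y ^+ 3) ^+ k * tau (x ^+ 3) (y ^+ 3) ^+ i
  = 'q ^ (- i%:Z) * x ^+ (12 * i) * y ^ ((3 * k)%N%:Z - (12 * i)%N%:Z).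
Proof.
move=> Uy; rewrite tauX !(exprnP _ 3) !exprz_exp (exprzDr Uy (3 * k)%N%:Z).
have -> : 3 * - (4 * i%:Z) = - (12 * i)%N%:Z by lia.
have -> : 3 * (4 * i%:Z) = (12 * i)%N%:Z by lia.
by rewrite -!exprnP -exprM; ring.
Qed.

(* The rows of the matrix x hold the coordinates of tau^i omega (k - 4 i). *)
Lemma odd_step_mat k (c d : nat -> int)
    (x00 x01 x02 x10 x11 x12 x20 x21 x22 : int) :
    omega t s k%:Z = x00%:~R + x01%:~R * tau t s + x02%:~R * tau t s ^+ 2 ->
    (c 1%N)%:~R * (tau t s * omega t s (k%:Z - 4))
      = (c 1%N)%:~R * (x10%:~R + x11%:~R * tau t s + x12%:~R * tau t s ^+ 2) ->
    (c 2%N)%:~R * (tau t s ^+ 2 * omega t s (k%:Z - 8))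
      = (c 2%N)%:~R * (x20%:~R + x21%:~R * tau t s + x22%:~R * tau t s ^+ 2) ->
    d 0%N = x00 * c 0%N + x10 * c 1%N + x20 * c 2%N ->
    d 1%N = x01 * c 0%N + x11 * c 1%N + x21 * c 2%N ->
    d 2%N = x02 * c 0%N + x12 * c 1%N + x22 * c 2%N ->
  odd_step k c d.
Proof.
rewrite /odd_step => -> -> -> -> -> ->.
by move: (tau _ _) (c _) (c _) (c _) => T c0 c1 c2; ring.
Qed.

Lemma solves0 h r : solves h r (0, 0, 0, 0) (fun=> 0).
Proof. by split=> // b; rewrite !mulr0. Qed.

Section Coefficients.
Variables (C : nat -> nat -> int) (D : nat -> nat -> nat -> int).
Hypothesis hC : forall k : nat, (1 <= k <= 8)%N ->
  solves (hrec k) (rrec k) (Cinit k) (C k).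
Hypothesis hD : forall k i : nat, (1 <= k <= 8)%N -> (1 <= i <= k %/ 3)%N ->
  solves (hrec k) (rrec k) (Dinit k i) (D k i).

(** [D k i] is constrained only for i <= floor(k/3); padding by 0 gives three coordinates for every
    k. *)
Definition Dpad k i b := if (i <= k %/ 3)%N then D k i b else 0.

Lemma solves_Dpad k i : (1 <= k <= 8)%N -> (1 <= i)%N ->
  solves (hrec k) (rrec k) (Dinit k i) (Dpad k i).
Proof.
move=> hk i1; have [ik|ik] := leqP i (k %/ 3).
  have := hD hk (_ : 1 <= i <= k %/ 3)%N; rewrite i1 ik => /(_ isT).
  by rewrite /Dpad ik.
(* Out of range, [Dinit] takes its default value. *)
have -> : Dinit k i = (0, 0, 0, 0).
  case: i i1 ik => [//|[|[|i]]] _; rewrite ltn_divLR// => ik.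
  - by case: k ik {hk} => [|[|[|k]]].
  - by case: k ik {hk} => [|[|[|[|[|[|k]]]]]].
  - by case: k {ik hk} => [|[|[|[|[|[|[|[|[|k]]]]]]]]].
by rewrite /Dpad leqNgt ik; apply: solves0.
Qed.

Definition coeffs k b i := if i is 0%N then C k b else Dpad k i b.

(** The constants are those of [trisect_odd_comb]; [even_lincomb] reduces each relation to
    arithmetic on initial values, k by k. *)
Lemma coeffs_even k : (1 <= k <= 8)%N -> forall b,
  even_step (coeffs k (2 * b + 1)%N) (coeffs k (2 * b.+1)%N).
Proof.
move=> hk b.
have [SC S1 S2] :=
  And3 (hC hk) (@solves_Dpad k 1 hk isT) (@solves_Dpad k 2 hk isT).
have E0 : C k (2 * b.+1)%N = 1 * C k (2 * b + 1)%N
    + - 12%:R * Dpad k 1 (2 * b + 1)%N + 252%:R * Dpad k 2 (2 * b + 1)%N.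
  move: SC S1 S2; case: k hk => [|[|[|[|[|[|[|[|[|k]]]]]]]]]// _ SC S1 S2;
  by apply: (even_lincomb SC SC S1 S2); rewrite /hrec /rrec; ring.
have E1 : Dpad k 1 (2 * b.+1)%N = 0 * C k (2 * b + 1)%N
    + - 243%:R * Dpad k 1 (2 * b + 1)%N + 0 * Dpad k 2 (2 * b + 1)%N.
  move: SC S1 S2 {E0}; case: k hk => [|[|[|[|[|[|[|[|[|k]]]]]]]]]// _ SC S1 S2;
  by apply: (even_lincomb S1 SC S1 S2); rewrite /hrec /rrec; ring.
have E2 : Dpad k 2 (2 * b.+1)%N = 0 * C k (2 * b + 1)%N
    + 0 * Dpad k 1 (2 * b + 1)%N + - 177147%:R * Dpad k 2 (2 * b + 1)%N.
  move: SC S1 S2 {E0 E1}; case: k hk => [|[|[|[|[|[|[|[|[|k]]]]]]]]]// _ SC S1 S2;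
  by apply: (even_lincomb S2 SC S1 S2); rewrite /hrec /rrec; ring.
rewrite /even_step /coeffs E0 E1 E2.
move: (C k _) (Dpad k 1 _) (Dpad k 2 _) => c0 c1 c2.
by split; ring.
Qed.

(** The rows come from the computed values of [omega]; [odd_lincomb] reduces each relation to
    arithmetic on initial values. *)
Lemma coeffs_odd k : (1 <= k <= 8)%N -> forall b,
  odd_step k (coeffs k (2 * b)%N) (coeffs k (2 * b + 1)%N).
Proof.
move=> hk b.
have [SC S1 S2] :=
  And3 (hC hk) (@solves_Dpad k 1 hk isT) (@solves_Dpad k 2 hk isT).
have Ut : t \is a GRing.unit by exact: euler_cube_unit.
have Us : s \is a GRing.unit by exact: euler_cube_unit.
have [tt nt] := (euler_cube_trisection, norm_euler_cube).
move: SC S1 S2; case: k hk => [|[|[|[|[|[|[|[|[|k]]]]]]]]]// _ SC S1 S2.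
(* Rows of index i > floor(k/3) are chosen zero, as [Dpad] is 0 there. *)
- apply: (@odd_step_mat _ _ _ (- 3%:R) 0 0 0 0 0 0 0 0).
  + by rewrite (omega1 Us tt);
      move: (tau _ _) => T; ring.
  + by rewrite !mul0r.
  + by rewrite !mul0r.
  + by apply: (odd_lincomb SC SC S1 S2); ring.
  + by apply: (odd_lincomb S1 SC S1 S2); ring.
  + by apply: (odd_lincomb S2 SC S1 S2); ring.
- apply: (@odd_step_mat _ _ _ 9%:R 0 0 0 0 0 0 0 0).
  + by rewrite (omega2 Us tt);
      move: (tau _ _) => T; ring.
  + by rewrite !mul0r.
  + by rewrite !mul0r.
  + by apply: (odd_lincomb SC SC S1 S2); ring.
  + by apply: (odd_lincomb S1 SC S1 S2); ring.
  + by apply: (odd_lincomb S2 SC S1 S2); ring.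
- apply: (@odd_step_mat _ _ _ 0 1 0 9%:R 0 0 0 0 0).
  + by rewrite (omega3 Ut Us tt nt);
      move: (tau _ _) => T; ring.
  + by rewrite (_ : 3%:Z - 4 = (-1))//
      (mul_tau_omegaN1 Ut Us tt nt);
      move: (tau _ _) => T; ring.
  + by rewrite !mul0r.
  + by apply: (odd_lincomb SC SC S1 S2); ring.
  + by apply: (odd_lincomb S1 SC S1 S2); ring.
  + by apply: (odd_lincomb S2 SC S1 S2); ring.
- apply: (@odd_step_mat _ _ _ (- 243%:R) (- 12%:R) 0 0 1 0 0 0 0).
  + by rewrite (omega4 Ut Us tt nt);
      move: (tau _ _) => T; ring.
  + by rewrite (_ : 4%:Z - 4 = 0)// (omega0 t s);
      move: (tau _ _) => T; ring.
  + by rewrite !mul0r.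
  + by apply: (odd_lincomb SC SC S1 S2); ring.
  + by apply: (odd_lincomb S1 SC S1 S2); ring.
  + by apply: (odd_lincomb S2 SC S1 S2); ring.
- apply: (@odd_step_mat _ _ _ 2187%:R 90%:R 0 0 (- 3%:R) 0 0 0 0).
  + by rewrite (omega5 Ut Us tt nt);
      move: (tau _ _) => T; ring.
  + by rewrite (_ : 5%:Z - 4 = 1)// (omega1 Us tt);
      move: (tau _ _) => T; ring.
  + by rewrite !mul0r.
  + by apply: (odd_lincomb SC SC S1 S2); ring.
  + by apply: (odd_lincomb S1 SC S1 S2); ring.
  + by apply: (odd_lincomb S2 SC S1 S2); ring.
- apply: (@odd_step_mat _ _ _ (- 13122%:R) (- 486%:R) 1 0 9%:R 0 243%:R 6%:R 0).
  + by rewrite (omega6 Ut Us tt nt);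
      move: (tau _ _) => T; ring.
  + by rewrite (_ : 6%:Z - 4 = 2)// (omega2 Us tt);
      move: (tau _ _) => T; ring.
  + by rewrite (_ : 6%:Z - 8 = (-2))//
      (mul_tau2_omegaN2 Ut Us tt nt);
      move: (tau _ _) => T; ring.
  + by apply: (odd_lincomb SC SC S1 S2); ring.
  + by apply: (odd_lincomb S1 SC S1 S2); ring.
  + by apply: (odd_lincomb S2 SC S1 S2); ring.
- apply: (@odd_step_mat _ _ _ 59049%:R 1701%:R (- 21%:R) 0 0 1 0 9%:R 0).
  + by rewrite (omega7 Ut Us tt nt);
      move: (tau _ _) => T; ring.
  + by rewrite (_ : 7%:Z - 4 = 3)// (omega3 Ut Us tt nt);
      move: (tau _ _) => T; ring.
  + by rewrite (_ : 7%:Z - 8 = (-1))//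
      expr2 -(mulrA (tau t s)) (mul_tau_omegaN1 Ut Us tt nt);
      move: (tau _ _) => T; ring.
  + by apply: (odd_lincomb SC SC S1 S2); ring.
  + by apply: (odd_lincomb S1 SC S1 S2); ring.
  + by apply: (odd_lincomb S2 SC S1 S2); ring.
- apply: (@odd_step_mat _ _ _ (- 177147%:R) 0 252%:R 0 (- 243%:R) (- 12%:R) 0 0 1).
  + by rewrite (omega8 Ut Us tt nt);
      move: (tau _ _) => T; ring.
  + by rewrite (_ : 8%:Z - 4 = 4)// (omega4 Ut Us tt nt);
      move: (tau _ _) => T; ring.
  + by rewrite (_ : 8%:Z - 8 = 0)// (omega0 t s);
      move: (tau _ _) => T; ring.
  + by apply: (odd_lincomb SC SC S1 S2); ring.
  + by apply: (odd_lincomb S1 SC S1 S2); ring.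
  + by apply: (odd_lincomb S2 SC S1 S2); ring.
Qed.
End Coefficients.

(** * Closed forms of the combinations, and the theorem *)

Lemma sum_Dpad D k b (F : nat -> laurent int) : (k <= 8)%N ->
  \sum_(1 <= i < (k %/ 3).+1) (D k i b)%:~R * F i
  = (Dpad D k 1 b)%:~R * F 1%N + (Dpad D k 2 b)%:~R * F 2%N.
Proof.
move=> k8; rewrite /Dpad; have : (k %/ 3 <= 2)%N by rewrite -ltnS ltn_divLR.
case: (k %/ 3)%N => [|[|[|//]]] _ /=.
- by rewrite big_geq// !mul0r addr0.
- by rewrite big_nat1 mul0r addr0.
- by rewrite big_nat_recr//= big_nat1.
Qed.

Lemma even_combE D k b c : (k <= 8)%N ->
  even_comb t s k c (Dpad D k 1 b) (Dpad D k 2 b)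
  = c%:~R * euler 1 ^+ (3 * k)
    + \sum_(1 <= i < (k %/ 3).+1) (D k i b)%:~R * 'q ^ i%:Z
        * euler 1 ^ ((3 * k)%N%:Z - (12 * i)%N%:Z) * euler 3 ^+ (12 * i).
Proof.
move=> k8; have Ue : euler 1 \is a GRing.unit by exact: euler_unit.
transitivity (c%:~R * euler 1 ^+ (3 * k) + \sum_(1 <= i < (k %/ 3).+1)
    (D k i b)%:~R * (t ^+ k * tau' t s ^+ i)).
  rewrite sum_Dpad// exprM /even_comb expr1.
  by move: (t ^+ k) (tau' _ _) => x y; ring.
congr (_ + _); apply: eq_bigr => i _.
by rewrite mul_exp_tau'// !mulrA.
Qed.

Lemma odd_combE D k b c : (k <= 8)%N ->
  odd_comb t s k c (Dpad D k 1 b) (Dpad D k 2 b)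
  = c%:~R * euler 3 ^+ (3 * k)
    + \sum_(1 <= i < (k %/ 3).+1) (D k i b)%:~R * 'q ^ (- i%:Z)
        * euler 1 ^+ (12 * i) * euler 3 ^ ((3 * k)%N%:Z - (12 * i)%N%:Z).
Proof.
move=> k8; have Ue : euler 3 \is a GRing.unit by exact: euler_unit.
transitivity (c%:~R * euler 3 ^+ (3 * k) + \sum_(1 <= i < (k %/ 3).+1)
    (D k i b)%:~R * (s ^+ k * tau t s ^+ i)).
  rewrite sum_Dpad// exprM /odd_comb expr1.
  by move: (s ^+ k) (tau _ _) => x y; ring.
congr (_ + _); apply: eq_bigr => i _.
by rewrite mul_exp_tau// !mulrA.
Qed.

Lemma solves_at0 h r init u : solves h r init u -> u 0%N = init.1.1.1.
Proof. by case: init => [[[a0 a1] a2] a3] []. Qed.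

Theorem theorem1p2 (C : nat -> nat -> int) (D : nat -> nat -> nat -> int)
    (hC : forall k : nat, (1 <= k <= 8)%N ->
       solves (hrec k) (rrec k) (Cinit k) (C k))
    (hD : forall k i : nat, (1 <= k <= 8)%N -> (1 <= i <= k %/ 3)%N ->
       solves (hrec k) (rrec k) (Dinit k i) (D k i))
    (b k : nat) (hk : (1 <= k <= 8)%N) :
  lseries 0 (fun n : int =>
      p (3 * k)%N ((3 ^ (2 * b))%N%:Z * n + (k * (3 ^ (2 * b) - 1) %/ 8)%N%:Z))
    = (C k (2 * b)%N)%:~R * euler 1 ^+ (3 * k)
      + \sum_(1 <= i < (k %/ 3).+1)
          (D k i (2 * b)%N)%:~R * 'q ^ i%:Z
            * euler 1 ^ ((3 * k)%N%:Z - (12 * i)%N%:Z) * euler 3 ^+ (12 * i)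
  /\
  lseries (- (k %/ 3)%N%:Z) (fun n : int =>
      p (3 * k)%N ((3 ^ (2 * b + 1))%N%:Z * n
                     + (k * (3 ^ (2 * b + 2) - 1) %/ 8)%N%:Z))
    = (C k (2 * b + 1)%N)%:~R * euler 3 ^+ (3 * k)
      + \sum_(1 <= i < (k %/ 3).+1)
          (D k i (2 * b + 1)%N)%:~R * 'q ^ (- i%:Z)
            * euler 1 ^+ (12 * i) * euler 3 ^ ((3 * k)%N%:Z - (12 * i)%N%:Z).
Proof.
have [_ k8] := andP hk.
(* The series t^k has coordinates (1, 0, 0), and these are the values of C and D at 0. *)
have C00 : C k 0%N = 1.
  by rewrite (solves_at0 (hC k hk)); case: k hk {k8} => [|[|[|[|[|[|[|[|[|]]]]]]]]].
have D00 i : (1 <= i)%N -> Dpad D k i 0%N = 0.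
  move=> i1; rewrite (solves_at0 (@solves_Dpad _ hD k i hk i1)).
  by case: k i {hk k8 i1 C00} => [|[|[|[|[|[|[|[|[|k]]]]]]]]] [|[|[|i]]].
have [E O] := series_comb (c := coeffs C D k) k8 C00 (D00 1%N isT) (D00 2%N isT)
  (@coeffs_odd _ _ hC hD k hk) (@coeffs_even _ _ hC hD k hk) b.
have -> : (2 * b + 2 = 2 * b.+1)%N by lia.
by split; [rewrite -even_combE | rewrite -odd_combE].
Qed.
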